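(* Consider the weighted hook walk for a partition $\lambda$ with positive weights $(x_i)_{i\in\mathbb{Z}},(y_j)_{j\in\mathbb{Z}}$ having finite sums. For an outer corner $c=(r,s)$ of $\lambda$ and a region $R$, let $P(c\mid R)$ be the probability that the walk terminates in $c$ conditional on its starting square lying in $R$, and let $P(c)$ be the (unconditional) probability that it terminates in $c$. Put \[ \Pi'_{rs}= \prod_{i = 1}^{r-1} \left(1 - \frac{x_i}{x_{i}+\cdots + x_{r-1} + y_{s} + \cdots + y_{\lambda_i}}\right) \cdot \prod_{j = 1}^{s-1} \left(1- \frac{y_j}{x_{r}+\cdots + x_{\lambda'_j} + y_{j} + \cdots + y_{s-1}}\right). \] Then (a) $P(c\mid R_5) = \dfrac{(x_r + \cdots + x_{\ell(\lambda)} + y_1 + \cdots + y_{s-1})(x_1 + \cdots + x_{r-1} + y_s + \cdots + y_{\lambda_1})}{\sum_{(p,q) \notin [\lambda],\,1\le p\le\ell(\lambda),\,1\le q\le\lambda_1} x_p y_q}\, \Pi'_{rs}$; (b) $P(c\mid R_6) = \dfrac{x_r + \cdots + x_{\ell(\lambda)} + y_1 + \cdots + y_{s-1}}{\sum_{p = 1}^{\ell(\lambda)} x_p}\, \Pi'_{rs}$; (c) $P(c\mid R_7) = \dfrac{x_1 + \cdots + x_{r-1} + y_s + \cdots + y_{\lambda_1}}{\sum_{q = 1}^{\lambda_1} y_q}\, \Pi'_{rs}$; (d) $P(c\mid R_8) = \Pi'_{rs}$. In particular, for each of (a)–(d), the sum of the given expression over all outer corners $(r,s)$ of $\lambda$ equals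 $1$. Moreover, (e) $P(c) = \dfrac {\left(x_1 + \cdots + x_{r-1} + \sum_{q\ge s} y_q\right) \left(\sum_{p\ge r} x_p + y_1 + \cdots + y_{s-1}\right)}{\left( \sum_{p\in\mathbb{Z}} x_p\right) \left( \sum_{q\in\mathbb{Z}} y_q\right)}\, \Pi'_{rs}$.
   Context: Let $\lambda=(\lambda_1\ge\cdots\ge\lambda_\ell>0)$ be a partition, $\ell=\ell(\lambda)$, with diagram $[\lambda]=\{(i,j)\in\mathbb{Z}^2:1\le i\le\ell,1\le j\le\lambda_i\}$ ($i$ = row, increasing downward; $j$ = column) and conjugate $\lambda'_j=\max\{i:\lambda_i\ge j\}$. Extend: $\lambda_i=\lambda_1$ for $i\le 0$, $\lambda_i=0$ for $i\ge\ell+1$, $\lambda'_j=\ell$ for $j\le 0$, $\lambda'_j=0$ for $j\ge\lambda_1+1$. A corner of $\lambda$ is $(i,j)\in[\lambda]$ with $(i+1,j),(i,j+1)\notin[\lambda]$; an outer corner is $(i,j)\notin[\lambda]$, $i,j\ge1$, with ($i=1$ or $(i-1,j)\in[\lambda]$) and ($j=1$ or $(i,j-1)\in[\lambda]$). Sums $x_a+\cdots+x_b$ with $b<a$ are $0$; conditional probabilities $P(c\mid R)$ are considered when $R$ is nonempty. Regions of $\mathbb{Z}^2$: $R_1=[\lambda]$; $R_2=\{1\le i\le\ell,\ j\le0\}$; $R_3=\{i\le0,\ 1\le j\le\lambda_1\}$; $R_4=\{i\le0,\ j\le0\}$; $R_5=\{1\le i\le\ell,\ 1\le j\le\lambda_1,\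 (i,j)\notin[\lambda]\}$; $R_6=\{1\le i\le\ell,\ j\ge\lambda_1+1\}$; $R_7=\{i\ge\ell+1,\ 1\le j\le\lambda_1\}$; $R_8=\{i\ge\ell+1,\ j\ge\lambda_1+1\}$; $R_9=\{i\ge\ell+1,\ j\le0\}$; $R_{10}=\{i\le0,\ j\ge\lambda_1+1\}$. Weighted hook walk: fix positive reals $x_i,y_j$ ($i,j\in\mathbb{Z}$) with $\sum_i x_i<\infty$, $\sum_j y_j<\infty$. The starting square $(i,j)\in\mathbb{Z}^2$ is chosen with probability $x_iy_j/((\sum_p x_p)(\sum_q y_q))$. If the current square $(i,j)$ lies in $D=R_1\cup R_2\cup R_3\cup R_4=\{(i,j): i\le \ell,\ j\le\lambda_i\}$, the walk moves to $(i',j)$ with $i<i'\le\lambda'_j$ with probability proportional to $x_{i'}$, or to $(i,j')$ with $j<j'\le\lambda_i$ with probability proportional to $y_{j'}$; it stops when no move is possible, i.e. at a corner of $\lambda$. If the current square lies in $D'=R_5\cup\cdots\cup R_8=\{(i,j): i\ge1,\ j\ge1,\ j>\lambda_i\}$, it moves to $(i',j)$ with $\lambda'_j<i'<i$ with probability proportional to $x_{i'}$, or to $(i,j')$ with $\lambda_i<j'<j$ with probability proportional to $y_{j'}$ (normalizing constant $x_{\lambda'_j+1}+\cdots+x_{i-1}+y_{\lambda_i+1}+\cdots+y_{j-1}$); it stops when no move is possible, i.e. at an outer corner of $\lambda$. Walks starting in $R_9$ (moving right or up) stop at $(\ell+1,0)$ and walks starting in $R_{10}$ (moving left or down) stop at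 $(0,\lambda_1+1)$; these are neither corners nor outer corners. *)

(* Defs.v *)
From HB Require Import structures.
From mathcomp Require Import all_boot all_order all_algebra.
From mathcomp Require Import all_classical all_reals all_analysis.

Set Implicit Arguments.
Unset Strict Implicit.
Unset Printing Implicit Defensive.

Import Order.TTheory GRing.Theory Num.Theory.

Local Open Scope classical_set_scope.
Local Open Scope ring_scope.

Definition square : Type := (int * int)%type.

(* The parts are stored in order; part number i (numbered from 1) is
   [nth 0 la i.-1] and the length of the partition is [size la]. The empty
   partition is allowed. *)
Definition is_partition (la : seq nat) : bool :=
  sorted geq la && all (fun m => 0 < m)%N la.

Definition len (la : seq nat) : int := (size la)%:Z.

(* Row lengths for all integer indices: the first part for i <= 0, and 0 beyond
   the last row (the default value of [nth]). *)
Definition lam (la : seq nat) (i : int) : int :=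
  (if i is Posz n.+1 then nth 0%N la n else head 0%N la)%:Z.

(* Column lengths for all integer indices: max {i : lam i >= j} for j >= 1,
   with max of the empty set equal to 0, and the number of rows for j <= 0. *)
Definition lam' (la : seq nat) (j : int) : int :=
  if j is Posz n.+1
  then (\max_(i < size la | (n.+1 <= nth 0 la i)%N) i.+1)%N%:Z
  else len la.

Definition diagram (la : seq nat) : set square :=
  [set c | 1 <= c.1 <= len la /\ 1 <= c.2 <= lam la c.1].

Definition outer_corner (la : seq nat) : set square :=
  [set c | [/\ ~ diagram la c, 1 <= c.1, 1 <= c.2,
               c.1 = 1 \/ diagram la (c.1 - 1, c.2) &
               c.2 = 1 \/ diagram la (c.1, c.2 - 1)]].

Definition R5 (la : seq nat) : set square :=
  [set c | [/\ 1 <= c.1 <= len la, 1 <= c.2 <= lam la 1 & ~ diagram la c]].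
Definition R6 (la : seq nat) : set square :=
  [set c | 1 <= c.1 <= len la /\ lam la 1 + 1 <= c.2].
Definition R7 (la : seq nat) : set square :=
  [set c | len la + 1 <= c.1 /\ 1 <= c.2 <= lam la 1].
Definition R8 (la : seq nat) : set square :=
  [set c | len la + 1 <= c.1 /\ lam la 1 + 1 <= c.2].

(* [inD] is the union of the regions R1, ..., R4. Together with [in9], [in10]
   and the union of R5, ..., R8 it partitions the plane. *)
Definition inD (la : seq nat) (c : square) : bool :=
  (c.1 <= len la) && (c.2 <= lam la c.1).
Definition in9 (la : seq nat) (c : square) : bool :=
  (len la + 1 <= c.1) && (c.2 <= 0).
Definition in10 (la : seq nat) (c : square) : bool :=
  (c.1 <= 0) && (lam la 1 + 1 <= c.2).

(* From (i, j) the walk may move to (i', j) with i' in [vrange la (i, j)] or to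
   (i, j') with j' in [hrange la (i, j)]: down or right in D, left or down in
   R10, right or up in R9, up or left in the union of R5, ..., R8. *)
Definition vrange (la : seq nat) (c : square) : interval int :=
  if inD la c || in10 la c then `]c.1, lam' la c.2] else `]lam' la c.2, c.1[.
Definition hrange (la : seq nat) (c : square) : interval int :=
  if inD la c || in9 la c then `]c.2, lam la c.1] else `]lam la c.1, c.2[.

Definition stopped (la : seq nat) (c : square) : Prop :=
  [set` vrange la c] = set0 /\ [set` hrange la c] = set0.

(* A walk that has stopped is continued as a constant sequence. *)
Definition step (R : realType) (la : seq nat) (x y : int -> R) (c c' : square)
    : R :=
  if `[< stopped la c >] then (c' == c)%:R else
  ((if (c'.2 == c.2) && (c'.1 \in vrange la c) then x c'.1 else 0) +
   (if (c'.1 == c.1) && (c'.2 \in hrange la c) then y c'.2 else 0)) /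
  (\sum_(i \in [set` vrange la c]) x i + \sum_(j \in [set` hrange la c]) y j).

(* Sum of a nonnegative family over a possibly infinite index set; it is the
   real sum as soon as the family is summable on A. *)
Definition tsum (R : realType) (x : int -> R) (A : set int) : R :=
  fine (\esum_(i in A) (x i)%:E).

Definition start (R : realType) (x y : int -> R) (c : square) : R :=
  x c.1 * y c.2 / (tsum x setT * tsum y setT).

(* W is a Markov chain on the squares with initial law [start] and transition
   probabilities [step]. *)
Record hook_walk (R : realType) (la : seq nat) (x y : int -> R)
    (d : measure_display) (T : measurableType d) (P : probability T R)
    (W : nat -> T -> square) : Prop := HookWalk {
  hook_walk_measurable : forall n c, measurable (W n @^-1` [set c]);
  hook_walk_law : forall n (p : nat -> square),
    P (\bigcap_(k in [set k : nat | (k <= n)%N]) (W k @^-1` [set p k])) =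
    (start x y (p 0%N) * \prod_(k < n) step la x y (p k) (p k.+1))%:E }.

Definition ends_at (la : seq nat) (T : Type) (W : nat -> T -> square)
    (c : square) : set T :=
  [set w | stopped la c /\ exists n, W n w = c].

Definition cprob (R : realType) (d : measure_display) (T : measurableType d)
    (P : probability T R) (A B : set T) : R :=
  fine (P (A `&` B)) / fine (P B).

Definition hook_prod (R : realType) (la : seq nat) (x y : int -> R)
    (c : square) : R :=
  let: (r, s) := c in
  (\big[*%R/1]_(i \in `[1, r - 1])
     (1 - x i / (\sum_(k \in `[i, r - 1]) x k +
                 \sum_(k \in `[s, lam la i]) y k))) *
  (\big[*%R/1]_(j \in `[1, s - 1])
     (1 - y j / (\sum_(k \in `[r, lam' la j]) x k +
                 \sum_(k \in `[j, s - 1]) y k))).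

Definition formula5 (R : realType) (la : seq nat) (x y : int -> R)
    (c : square) : R :=
  let: (r, s) := c in
  (\sum_(k \in `[r, len la]) x k + \sum_(k \in `[1, s - 1]) y k) *
  (\sum_(k \in `[1, r - 1]) x k + \sum_(k \in `[s, lam la 1]) y k) /
  (\sum_(e \in R5 la) (x e.1 * y e.2)) * hook_prod la x y c.

Definition formula6 (R : realType) (la : seq nat) (x y : int -> R)
    (c : square) : R :=
  let: (r, s) := c in
  (\sum_(k \in `[r, len la]) x k + \sum_(k \in `[1, s - 1]) y k) /
  (\sum_(k \in `[1, len la]) x k) * hook_prod la x y c.

Definition formula7 (R : realType) (la : seq nat) (x y : int -> R)
    (c : square) : R :=
  let: (r, s) := c in
  (\sum_(k \in `[1, r - 1]) x k + \sum_(k \in `[s, lam la 1]) y k) /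
  (\sum_(k \in `[1, lam la 1]) y k) * hook_prod la x y c.

Definition formula8 (R : realType) (la : seq nat) (x y : int -> R)
    (c : square) : R := hook_prod la x y c.

Definition formula_all (R : realType) (la : seq nat) (x y : int -> R)
    (c : square) : R :=
  let: (r, s) := c in
  (\sum_(k \in `[1, r - 1]) x k + tsum y `[s, +oo[) *
  (tsum x `[r, +oo[ + \sum_(k \in `[1, s - 1]) y k) /
  (tsum x setT * tsum y setT) * hook_prod la x y c.

(* Main.v *)
(** Fix an outer corner (r, s). A walk that ends there stays in the quadrant
    i >= r, j >= s, and on this quadrant the normalizing constant of the
    square (i, j) splits as A i + B j, where
      A i = x_r + ... + x_(i-1) + y_(lam_i + 1) + ... + y_(s-1)
    and B is its transpose. Hence the probability of ending in (r, s) from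
    (i, j) factors as f i * g j, where A i * f i is the sum of the x_k * f k
    over r <= k < i (and likewise for g). So f (i+1) / f i = (A i + x_i) / A (i+1),
    which makes f constant below the diagram; there the product over i
    telescopes, column by column, into the second factor of Pi'_(rs). All the
    formulas are then sums over rectangles of x_i * f i * y_j * g j, evaluated
    by the same recurrence. The sums over outer corners are 1 because the
    f i * g j of all corners add up to a function that is harmonic for the walk
    outside the diagram and is 1 at
    every outer corner. *)

Require Import Defs.
From HB Require Import structures.
From mathcomp Require Import all_boot all_order all_algebra.
From mathcomp Require Import all_classical all_reals all_analysis.
From mathcomp Require Import ring lra zify.

Set Implicit Arguments.
Unset Strict Implicit.
Unset Printing Implicit Defensive.

Import Order.TTheory GRing.Theory Num.Theory.

Local Open Scope classical_set_scope.
Local Open Scope ring_scope.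

(** * Sums over integer intervals *)

Lemma set_itv_int (a : int) (n : nat) :
  `[a, a + n%:Z - 1]%classic = [set` [seq a + k%:Z | k <- iota 0 n]].
Proof.
apply/seteqP; split=> k /=.
- rewrite in_itv /= => /andP[ak kn]; apply/mapP; exists (absz (k - a)%R); last lia.
  by rewrite mem_iota; lia.
- by move=> /mapP[i]; rewrite mem_iota => /andP[_ il] ->; rewrite in_itv /=; lia.
Qed.

Lemma finite_itv_int (a b : int) : finite_set `[a, b]%classic.
Proof.
have [ab|ba] := leP a b.
  have -> : b = a + Posz (absz (b + 1 - a)%R) - 1 by lia.
  by rewrite set_itv_int; exact: finite_seq.
suff -> : `[a, b]%classic = set0 by [].
by apply/seteqP; split=> k //=; rewrite in_itv /=; lia.
Qed.
#[local] Hint Resolve finite_itv_int : core.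

(** The length [n] is a parameter so that an empty interval, with [b = a - 1], is the case
    [n = 0]. *)
Lemma fsbig_itv (T : Type) (idx : T) (op : Monoid.com_law idx) (F : int -> T)
    (a b : int) (n : nat) : b = a + n%:Z - 1 ->
  \big[op/idx]_(k \in `[a, b]) F k = \big[op/idx]_(k < n) F (a + k%:Z).
Proof.
move=> ->; rewrite set_itv_int -fsbig_seq; last first.
  by rewrite map_inj_uniq ?iota_uniq// => i j; lia.
by rewrite big_map -{1}[n]subn0 -/(index_iota 0 n) big_mkord.
Qed.

Lemma itv_oo_int (a b : int) : `]a, b[%classic = `[a + 1, b - 1]%classic.
Proof. by apply/seteqP; split=> k /=; rewrite !in_itv /=; lia. Qed.

Lemma itv_oc_int (a b : int) : `]a, b]%classic = `[a + 1, b]%classic.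
Proof. by apply/seteqP; split=> k /=; rewrite !in_itv /=; lia. Qed.

Lemma fsbig_itv_cat (T : Type) (idx : T) (op : Monoid.com_law idx) (F : int -> T)
    (a b c : int) : a <= b + 1 -> b <= c ->
  \big[op/idx]_(k \in `[a, c]) F k =
  op (\big[op/idx]_(k \in `[a, b]) F k) (\big[op/idx]_(k \in `[b + 1, c]) F k).
Proof.
move=> ab bc; rewrite -fsbigU0 //.
  by congr (\big[_/_]_(_ \in _) _); apply/seteqP; split=> k /=; rewrite !in_itv /=; lia.
by move=> k /= []; rewrite !in_itv /=; lia.
Qed.

Lemma prod_telescope (R : fieldType) (Z : int -> R) (a b : int) : a <= b + 1 ->
  (forall k, a <= k -> k <= b + 1 -> Z k != 0) ->
  \big[*%R/1]_(k \in `[a, b]) (Z (k + 1) / Z k) = Z (b + 1) / Z a.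
Proof.
move=> ab; have -> : b = a + Posz (absz (b + 1 - a)%R) - 1 by lia.
rewrite (fsbig_itv _ _ erefl) subrK.
elim: (absz (b + 1 - a)%R) => [|n IH] Z0.
  by rewrite big_ord0 addr0 divff //; apply: Z0; lia.
rewrite big_ord_recr /= IH => [|k ka kn]; last by apply: Z0; lia.
have -> : a + n.+1%:Z = a + n%:Z + 1 by lia.
by field; apply/andP; split; apply: Z0; lia.
Qed.

(** A discrete antiderivative of [x] on all of the integers, normalized to vanish at 0. Sums over
    intervals become differences of its values, whatever the signs of the endpoints, so that [ring]
    and [field] apply to them. *)
Definition psum (R : zmodType) (x : int -> R) (i : int) : R :=
  match i with
  | Posz n => \sum_(k < n) x k%:Z
  | Negz n => - \sum_(k < n.+1) x (Negz k)
  end.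

Lemma psumS (R : zmodType) (x : int -> R) (i : int) :
  psum x (i + 1) = psum x i + x i.
Proof.
case: i => [n|[|n]].
- have -> : n%:Z + 1 = Posz n.+1 by lia.
  by rewrite /= big_ord_recr.
- have -> : Negz 0 + 1 = Posz 0 by lia.
  by rewrite /= big_ord1 big_ord0 addNr.
- have -> : Negz n.+1 + 1 = Negz n by lia.
  by rewrite /= [in RHS]big_ord_recr opprD addrNK.
Qed.

Lemma sum_itv (R : zmodType) (x : int -> R) (a b : int) : a <= b + 1 ->
  \sum_(k \in `[a, b]) x k = psum x (b + 1) - psum x a.
Proof.
move=> ab; have eb : b = a + Posz (absz (b + 1 - a)%R) - 1 by lia.
rewrite (fsbig_itv _ _ eb) [in RHS]eb.
elim: (absz (b + 1 - a)%R) => [|n IH]; first by rewrite big_ord0 addr0 addrNK subrr.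
rewrite big_ord_recr /= IH.
have -> : a + n.+1%:Z - 1 + 1 = a + n%:Z + 1 by lia.
by rewrite subrK psumS; exact: addrAC.
Qed.

Lemma psum_le (R : numDomainType) (x : int -> R) (x_ge0 : forall i, 0 <= x i)
  (a b : int) : a <= b -> psum x a <= psum x b.
Proof.
move=> ab; have -> : b = a + Posz (absz (b - a)%R) by lia.
elim: (absz (b - a)%R) => [|n IH]; first by rewrite addr0.
have -> : a + n.+1%:Z = a + n%:Z + 1 by lia.
by rewrite psumS; apply: (le_trans IH); rewrite lerDl.
Qed.

Lemma psum_lt (R : numDomainType) (x : int -> R) (x_gt0 : forall i, 0 < x i)
  (a b : int) : a < b -> psum x a < psum x b.
Proof.
move=> ab; apply: (@lt_le_trans _ _ (psum x (a + 1))).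
  by rewrite psumS ltrDl.
by apply: psum_le => [i|]; [exact: ltW|lia].
Qed.

(** * The linear recurrence behind the row and column factors *)

Section line_weight.
Variables (R : numFieldType) (u A : int -> R) (r : int).

(* The solution of [A a * w a = sum of u k * w k over r <= k < a] with [w r = 1]. *)
Definition line_weight (a : int) : R :=
  if a < r then 0
  else \prod_(k < absz (a - r)%R) ((A (r + k%:Z) + u (r + k%:Z)) / A (r + k%:Z + 1)).

Lemma line_weight0 (a : int) : a < r -> line_weight a = 0.
Proof. by rewrite /line_weight => ->. Qed.

Lemma line_weight_start : line_weight r = 1.
Proof. by rewrite /line_weight ltxx subrr big_ord0. Qed.

Lemma line_weightS (a : int) : r <= a ->
  line_weight (a + 1) = line_weight a * ((A a + u a) / A (a + 1)).
Proof.
move=> ra; rewrite /line_weight !ifF; try lia.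
have -> : (absz (a + 1 - r)%R) = (absz (a - r)%R).+1 by lia.
by rewrite big_ord_recr /=; have -> : r + Posz (absz (a - r)%R) = a by lia.
Qed.

Lemma line_weight_ge0 (a : int) : (forall k, 0 <= u k) ->
  (forall k, r <= k -> 0 <= A k) -> 0 <= line_weight a.
Proof.
move=> u0 A0; rewrite /line_weight; case: ifP => // _.
by apply: prodr_ge0 => k _; apply: divr_ge0; rewrite ?addr_ge0// A0; lia.
Qed.

Lemma line_weight_const (a b : int) :
  (forall k, a <= k -> A (k + 1) = A k + u k) -> (forall k, r < k -> A k != 0) ->
  r <= a -> a <= b -> line_weight b = line_weight a.
Proof.
move=> AS A0 ra ab; have -> : b = a + Posz (absz (b - a)%R) by lia.
elim: (absz (b - a)%R) => [|n IH]; first by rewrite addr0.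
have -> : a + n.+1%:Z = a + n%:Z + 1 by lia.
rewrite line_weightS; last lia.
by rewrite AS ?divff ?mulr1 // -?AS ?A0; lia.
Qed.

(** Induction on [a]: the recurrence makes [A a * w a + u a * w a] equal to [A (a + 1) * w (a + 1)].
    The lower end [b] may lie before [r] because the weights vanish there; the ranges of the walk do
    start before [r]. *)
Lemma sum_line_weight (a b : int) : A r = 0 -> (forall k, r < k -> A k != 0) ->
  b <= r -> r <= a ->
  \sum_(k \in `[b, a - 1]) u k * line_weight k = A a * line_weight a.
Proof.
move=> Ar A0 br ra.
have -> : \sum_(k \in `[b, a - 1]) u k * line_weight k =
          \sum_(k \in `[r, a - 1]) u k * line_weight k.
  symmetry; apply: fsbig_widen => k /=; rewrite !in_itv /=; first lia.
  by move=> [kb kr]; rewrite line_weight0 ?mulr0//; lia.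
have -> : a = r + Posz (absz (a - r)%R) by lia.
rewrite (fsbig_itv _ _ erefl).
elim: (absz (a - r)%R) => [|n IH]; first by rewrite big_ord0 addr0 Ar mul0r.
have -> : r + n.+1%:Z = r + n%:Z + 1 by lia.
rewrite big_ord_recr IH line_weightS /=; last lia.
by field; apply: A0; lia.
Qed.
End line_weight.

(** * Partitions and their outer corners *)

(* The list of properties is invariant under transposition, so that every
   statement on rows below also yields the one on columns. *)
Record conjugate_shapes (l m : int) (mu mu' : int -> int) : Prop :=
  ConjugateShapes {
  cs_ge0 : 0 <= l /\ 0 <= m;
  cs_bound : forall i, 0 <= mu i <= m;
  cs_bound' : forall j, 0 <= mu' j <= l;
  cs_low : forall i, i <= 0 -> mu i = m;
  cs_low' : forall j, j <= 0 -> mu' j = l;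
  cs_high : forall i, l < i -> mu i = 0;
  cs_high' : forall j, m < j -> mu' j = 0;
  cs_galois : forall i j, 1 <= i -> 1 <= j -> (j <= mu i) = (i <= mu' j) }.

Lemma conjugate_shapesC (l m : int) (mu mu' : int -> int) :
  conjugate_shapes l m mu mu' -> conjugate_shapes m l mu' mu.
Proof. by case=> [[? ?] ? ? ? ? ? ? g]; split=> // i j i1 j1; rewrite g. Qed.

Lemma cs_mono (l m : int) (mu mu' : int -> int) : conjugate_shapes l m mu mu' ->
  forall i j, i <= j -> mu j <= mu i.
Proof.
move=> S i j ij; have := cs_bound S i; have := cs_bound S j.
have [i0|i0] := leP i 0; first by rewrite (cs_low S i0); lia.
have [|mj] := leP (mu j) 0; first lia.
have := @cs_galois _ _ _ _ S i (mu j); have := @cs_galois _ _ _ _ S j (mu j); lia.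
Qed.

(** Both sides describe the region D, which is symmetric under transposition. Without the two bounds
    the equivalence fails at nonpositive indices, for instance in R10. *)
Lemma cs_galoisD (l m : int) (mu mu' : int -> int) : conjugate_shapes l m mu mu' ->
  forall i j, (i <= l) && (j <= mu i) = (j <= m) && (i <= mu' j).
Proof.
move=> S i j; have [i0|i0] := leP i 0.
  have := cs_low S i0; have := cs_bound' S j; have := cs_ge0 S.
  by lia.
have [j0|j0] := leP j 0.
  have := cs_low' S j0; have := cs_bound S i; have := cs_ge0 S.
  by lia.
have := cs_galois S i0 j0; have := cs_bound S i; have := cs_bound' S j.
by lia.
Qed.

Lemma len_ge0 (la : seq nat) : 0 <= len la. Proof. by []. Qed.

Lemma partition_shapes (la : seq nat) : is_partition la ->
  conjugate_shapes (len la) (lam la 1) (lam la) (lam' la).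
Proof.
move=> /andP[srt pos].
have head0 : lam la 1 = (head 0%N la)%:Z by case: la {srt pos}.
have mono i j : (i <= j)%N -> (nth 0 la j <= nth 0 la i)%N.
  move=> ij; have [jl|jl] := ltnP j (size la); last by rewrite [nth _ _ j]nth_default.
  have trG : transitive geq by move=> a b c /= ba /leq_trans; exact.
  exact: (sorted_leq_nth trG leqnn 0%N srt i j (leq_ltn_trans ij jl) jl ij).
have gal n k : (k < nth 0 la n)%N =
    (n < \max_(i < size la | (k.+1 <= nth 0 la i)%N) i.+1)%N.
  apply/idP/idP => [kn|].
    have nl : (n < size la)%N.
      by rewrite ltnNge; apply/negP => h; rewrite nth_default in kn.
    exact: (@leq_bigmax_cond _ _ _ (Ordinal nl)).
  (* Contrapositive: if row [n] does not reach column [k], then by monotonicity every row that does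
     has a smaller index. *)
  apply: contraTT; rewrite -!leqNgt => nk; apply/bigmax_leqP => i ki.
  by rewrite ltnNge; apply/negP => /mono; lia.
rewrite head0; split => //.
- by case=> [[|n]|n]; rewrite /lam ?lexx // -nth0; have := mono 0%N n; lia.
- case=> [[|n]|n]; rewrite /lam' /len ?lexx //.
  have : (\max_(i < size la | (n < nth 0 la i)%N) i.+1 <= size la)%N.
    exact/bigmax_leqP.
  by lia.
- by case=> [[|n]|n].
- by case=> [[|n]|n].
- by case=> [[|n]|n] // h; rewrite /lam nth_default //; move: h; rewrite /len; lia.
- case=> [[|n]|n] // h; rewrite /lam' big_pred0 // => i.
  by have := mono 0%N i; rewrite nth0; lia.
- by case=> [[|n]|n] // [[|k]|k] // _ _; rewrite /lam /lam' !lez_nat; exact: gal.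
Qed.

(** Outer corners described by lengths alone. This form covers the boundary cases r = 1 and s = 1
    uniformly and is invariant under transposition. *)
Definition corner (mu mu' : int -> int) (r s : int) : Prop :=
  [/\ 1 <= r, 1 <= s, mu r = s - 1 & mu' s = r - 1].

Lemma outer_cornerP (la : seq nat) (r s : int) : is_partition la ->
  outer_corner la (r, s) <-> corner (lam la) (lam' la) r s.
Proof.
move=> /partition_shapes S; rewrite /outer_corner /corner /diagram /=.
have bs := cs_bound S; have bs' := cs_bound' S; have g := cs_galois S.
have hi := cs_high S; have hi' := cs_high' S; have l0 := len_ge0 la.
split.
- move=> [nd r1 s1 hr hs]; have ns : lam la r < s.
    by rewrite ltNge; apply/negP => h; apply: nd; have := hi r; lia.
  have nr : lam' la s < r by rewrite ltNge -g // -ltNge.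
  split=> //.
    by case: hs => [|[]]; have := bs r; lia.
  by case: hr => [|[h1 h2]]; have := bs' s; [|have := g (r - 1) s]; lia.
- move=> [r1 s1 er es]; split=> //.
  + by move=> []; lia.
  + have [->|r2] := eqVneq r 1; [by left|right].
    by have := g (r - 1) s; have := hi (r - 1); lia.
  + have [->|r2] := eqVneq s 1; [by left|right].
    by have := hi r; lia.
Qed.

(** * The factors of the absorption probabilities *)

Section slack.
Variables (R : numFieldType) (x y : int -> R).
Hypotheses (x_gt0 : forall i, 0 < x i) (y_gt0 : forall j, 0 < y j).

(* For k >= r, [slack mu r s k] = x_r + ... + x_(k-1) + y_(mu k + 1) + ... + y_(s-1);
   it depends only on the row, and adding its transpose for the column gives the
   normalizing constant of the walk. *)
Definition slack (mu : int -> int) (r s k : int) : R :=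
  psum x k - psum x r + (psum y s - psum y (mu k + 1)).

Variables (l m : int) (mu mu' : int -> int).
Hypothesis S : conjugate_shapes l m mu mu'.
Variables (r s : int).
Hypothesis rs : corner mu mu' r s.

Lemma corner_bound : 1 <= r <= l + 1.
Proof. by case: rs => ? ? ? h; have := cs_bound' S s; lia. Qed.

Lemma corner_mu_lt (k : int) : r <= k -> mu k < s.
Proof. by move=> rk; case: rs => ? ? e _; have := cs_mono S rk; lia. Qed.

Lemma corner_mu'_lt (k : int) : s <= k -> mu' k < r.
Proof.
by move=> rk; case: rs => ? ? _ e; have := cs_mono (conjugate_shapesC S) rk; lia.
Qed.

Lemma slack_start : slack mu r s r = 0.
Proof. by case: rs => _ _ e _; rewrite /slack e subrK !subrr addr0. Qed.

Lemma slack_gt0 (k : int) : r < k -> 0 < slack mu r s k.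
Proof.
move=> rk; rewrite /slack ltr_wpDr ?subr_ge0 ?subr_gt0 ?psum_lt //.
by apply: psum_le => [j|]; [exact: ltW | have := @corner_mu_lt k; lia].
Qed.

Lemma slack_ge0 (k : int) : r <= k -> 0 <= slack mu r s k.
Proof.
rewrite le_eqVlt => /predU1P[<-|/slack_gt0/ltW//].
by rewrite slack_start.
Qed.

Lemma slack_last : slack mu r s (l + 1) =
  \sum_(k \in `[r, l]) x k + \sum_(k \in `[1, s - 1]) y k.
Proof.
have := corner_bound; case: rs => r1 s1 _ _ rl.
rewrite /slack (cs_high S) ?add0r; last lia.
by rewrite !sum_itv ?subrK //; lia.
Qed.

(** The factor f of the absorption probability. The factor g is the same object with [x] and [y],
    [mu] and [mu'], [r] and [s] exchanged. *)
Definition row_weight : int -> R := line_weight x (slack mu r s) r.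

Lemma row_weight0 (k : int) : k < r -> row_weight k = 0.
Proof. exact: line_weight0. Qed.

Lemma row_weight_ge0 (k : int) : 0 <= row_weight k.
Proof. by apply: line_weight_ge0 => i; [exact: ltW|exact: slack_ge0]. Qed.

(** Below the diagram [mu] is 0, so [slack] grows by exactly [x i] from row [i] to the next, and the
    ratio of consecutive weights is 1. *)
Lemma row_weight_const (k : int) : l < k -> row_weight k = row_weight (l + 1).
Proof.
move=> lk; have rl := corner_bound; apply: line_weight_const; try lia.
- by move=> i li; rewrite /slack psumS !(cs_high S); [ring|lia|lia].
- by move=> i ri; rewrite gt_eqF // slack_gt0.
Qed.

Lemma sum_row_weight (a b : int) : b <= r -> r <= a ->
  \sum_(k \in `[b, a - 1]) x k * row_weight k = slack mu r s a * row_weight a.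
Proof.
move=> br ra; apply: sum_line_weight => //; first exact: slack_start.
by move=> k rk; rewrite gt_eqF // slack_gt0.
Qed.

Lemma row_weight_prod :
  \big[*%R/1]_(j \in `[1, s - 1])
    (1 - y j / (\sum_(k \in `[r, mu' j]) x k + \sum_(k \in `[j, s - 1]) y k)) =
  row_weight (l + 1).
Proof.
set T := fun j => 1 - y j / _.
have rl := corner_bound; have [r1 s1 er es] := rs.
(* Generalized to be proved row by row: at [k = r] the product is empty, and at [k = l + 1] it runs
   over all columns before [s]. *)
suff H k : r <= k -> \big[*%R/1]_(j \in `[mu k + 1, s - 1]) T j = row_weight k.
  by rewrite -H ?(cs_high S) //; lia.
move=> rk; have -> : k = r + Posz (absz (k - r)%R) by lia.
elim: (absz (k - r)%R) => [|n IH].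
  rewrite addr0 er /row_weight line_weight_start.
  by rewrite (@fsbig_itv _ _ _ _ _ _ 0) ?big_ord0 //; lia.
have -> : r + n.+1%:Z = r + n%:Z + 1 by lia.
move: IH; set i := r + n%:Z => IH; have ri : r <= i by lia.
have le1 : mu (i + 1) <= mu i by apply: (cs_mono S); lia.
have lt1 := corner_mu_lt ri; have ge1 := cs_bound S (i + 1).
rewrite (@fsbig_itv_cat _ _ _ _ _ (mu i)) ?IH; try lia.
rewrite [RHS]line_weightS // [RHS]mulrC; congr (_ * _).
(* [Z j] is x_r + ... + x_i + y_j + ... + y_(s-1), the denominator of the factor at a column [j] of
   height [i]; that factor is then [Z (j + 1) / Z j]. *)
pose Z j := psum x (i + 1) - psum x r + psum y s - psum y j.
have Z_gt0 j : j <= s -> 0 < Z j.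
  move=> js; rewrite /Z -addrA ltr_wpDr ?subr_ge0 ?subr_gt0 ?psum_lt //; last lia.
  by apply: psum_le => // k'; exact: ltW.
transitivity (\big[*%R/1]_(j \in `[mu (i + 1) + 1, mu i]) (Z (j + 1) / Z j)).
  apply: eq_fsbigr => j; rewrite inE /= in_itv /= => /andP[j1 j2].
  (* The columns gained in passing from row [i] to row [i + 1] are those ending exactly in row
     [i]. *)
  have ej : mu' j = i.
    have := @cs_galois _ _ _ _ S i j; have := @cs_galois _ _ _ _ S (i + 1) j; lia.
  have := @Z_gt0 j; rewrite /T ej !sum_itv; try lia.
  rewrite subrK /Z (psumS y) => /(_ ltac:(lia)) /lt0r_neq0 h.
  by field.
rewrite prod_telescope; try lia; last first.
  by move=> k' _ k1; rewrite gt_eqF // Z_gt0 //; lia.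
by rewrite /Z /slack (psumS x); congr (_ / _); ring.
Qed.

End slack.

(** * Harmonicity of the absorption probabilities *)

Lemma cornerC (mu mu' : int -> int) (r s : int) :
  corner mu mu' r s -> corner mu' mu s r.
Proof. by case. Qed.

(* Probability that the walk from p ends in the outer corner c. *)
Definition absorb (R : numFieldType) (x y : int -> R) (mu mu' : int -> int)
    (c p : square) : R :=
  row_weight x y mu c.1 c.2 p.1 * row_weight y x mu' c.2 c.1 p.2.

Definition corners (mu mu' : int -> int) : set square :=
  [set c | corner mu mu' c.1 c.2].

Section absorb.
Variables (R : numFieldType) (x y : int -> R).
Hypotheses (x_gt0 : forall i, 0 < x i) (y_gt0 : forall j, 0 < y j).
Variables (l m : int) (mu mu' : int -> int).
Hypothesis S : conjugate_shapes l m mu mu'.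
Let S' := conjugate_shapesC S.
Local Notation absorb := (absorb x y mu mu').

Lemma finite_corners : finite_set (corners mu mu').
Proof.
apply: (@sub_finite_set _ _ (`[1, l + 1]%classic `*` `[1, m + 1]%classic)).
  move=> [r s] rs; rewrite /= !in_itv /=.
  have := corner_bound S rs; have := corner_bound S' (cornerC rs).
  by move=> ? ?; split.
exact: finite_setX.
Qed.

Lemma absorb_ge0 (c p : square) : corners mu mu' c -> 0 <= absorb c p.
Proof.
move=> h; apply: mulr_ge0; first exact: (row_weight_ge0 _ _ S h).
exact: (row_weight_ge0 _ _ S' (cornerC h)).
Qed.

Lemma absorb_low (c p : square) : p.1 < c.1 \/ p.2 < c.2 -> absorb c p = 0.
Proof.
case=> h; rewrite /absorb; first by rewrite row_weight0 ?mul0r.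
by rewrite [X in _ * X]row_weight0 ?mulr0.
Qed.

(** Every column from [c.2] on ends above row [c.1], so such a square lies outside the quadrant of
    [c]. With [absorb_row], this settles all squares of D, R9 and R10. *)
Lemma absorb_col (c p : square) : corners mu mu' c -> p.1 <= mu' p.2 -> absorb c p = 0.
Proof.
move=> h h1; apply: absorb_low; have [|cp] := ltP p.2 c.2; first by right.
by left; exact: le_lt_trans h1 (corner_mu'_lt S h cp).
Qed.

Lemma absorb_row (c p : square) : corners mu mu' c -> p.2 <= mu p.1 -> absorb c p = 0.
Proof.
move=> h h1; apply: absorb_low; have [|cp] := ltP p.1 c.1; first by left.
by right; exact: le_lt_trans h1 (corner_mu_lt S h cp).
Qed.

Lemma absorb_self (c : square) : absorb c c = 1.
Proof. by rewrite /absorb /row_weight !line_weight_start mulr1. Qed.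

Lemma absorb_corner (c c' : square) : corners mu mu' c -> corners mu mu' c' ->
  absorb c c' = (c' == c)%:R.
Proof.
move=> h h'; have [->|ne] := eqVneq c' c; first exact: absorb_self.
apply: absorb_low; have [?|r1] := ltP c'.1 c.1; first by left.
have [?|s1] := ltP c'.2 c.2; first by right.
have := corner_mu_lt S h r1; have := corner_mu'_lt S h s1.
(* If [c'] lay in the quadrant of [c], the row and column ending just before [c'] would have to end
   before [c], which forces [c' = c]. *)
case: h' => _ _ -> -> a1 a2; exfalso; move/eqP: ne; apply.
move: c c' {h} r1 s1 a1 a2 => [r s] [r' s'] /= r1 s1 a1 a2.
by have [-> ->] : r' = r /\ s' = s by lia.
Qed.

(** In the quadrant of [c], the vertical sum yields the row slack and the horizontal sum the column
    slack, each times [absorb c (i, j)]. Outside it every term vanishes, since moves go only up or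
    left. *)
Lemma absorb_harmonic (c : square) (i j : int) : corners mu mu' c ->
  mu i < j -> mu' j < i ->
  (\sum_(k \in `[mu' j + 1, i - 1]) x k + \sum_(k \in `[mu i + 1, j - 1]) y k) *
    absorb c (i, j) =
  \sum_(k \in `[mu' j + 1, i - 1]) x k * absorb c (k, j) +
  \sum_(k \in `[mu i + 1, j - 1]) y k * absorb c (i, k).
Proof.
case: c => r s h ij ji.
have [ir|ri] := ltP i r.
  rewrite absorb_low ?mulr0; last by left.
  rewrite !fsbig1 ?addr0 // => k; rewrite /= in_itv /= => kb.
    by rewrite absorb_low ?mulr0 //; left.
  by rewrite absorb_low ?mulr0 //=; left; rewrite /=; lia.
have [js|sj] := ltP j s.
  rewrite absorb_low ?mulr0; last by right.
  rewrite !fsbig1 ?addr0 // => k; rewrite /= in_itv /= => kb.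
    by rewrite absorb_low ?mulr0 //=; right; rewrite /=; lia.
  by rewrite absorb_low ?mulr0 //; right.
have mur := corner_mu_lt S h ri; have mus := corner_mu'_lt S h sj.
under [X in _ = X + _]eq_fsbigr => k _ do rewrite /absorb /= mulrA.
rewrite -mulr_fsuml (sum_row_weight x_gt0 y_gt0 S h) //; last lia.
under [X in _ = _ + X]eq_fsbigr => k _ do rewrite /absorb /= mulrCA.
rewrite -mulr_fsumr (sum_row_weight y_gt0 x_gt0 S' (cornerC h)) //; last lia.
(* The terms [psum x r] and [psum y s] occur with both signs in the two slacks and cancel, leaving
   the normalizing constant. *)
by rewrite !sum_itv ?subrK; [rewrite /absorb /slack /=; ring|lia|lia].
Qed.

(** Moves in this region decrease [i + j], so by harmonicity the value 1 at the outer corners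
    propagates to all its squares. *)
Lemma sum_absorb (i j : int) : 1 <= i -> 1 <= j -> mu i < j ->
  \sum_(c \in corners mu mu') absorb c (i, j) = 1.
Proof.
have [n] := ubnP (absz (i + j)); elim: n i j => // n IH i j nij i1 j1 ij.
have ji : mu' j < i by have := cs_galois S i1 j1; lia.
have mu0 := cs_bound S i; have mu'0 := cs_bound' S j.
(* If both ranges are empty, the square is an outer corner and only its own term survives. *)
have [/andP[/eqP ei /eqP ej]|nc] := boolP ((mu' j == i - 1) && (mu i == j - 1)).
  have cij : corners mu mu' (i, j) by [].
  rewrite (fsbigD1 (i, j)) //=; last exact: finite_corners.
  rewrite absorb_self fsbig1 ?addr0 //.
  by move=> c [hc /eqP ne]; rewrite absorb_corner // eq_sym (negbTE ne).
set N := \sum_(k \in `[mu' j + 1, i - 1]) x k + \sum_(k \in `[mu i + 1, j - 1]) y k.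
have N_gt0 : 0 < N.
  rewrite /N !sum_itv ?subrK; try lia.
  have := nc; rewrite negb_and => /orP[ne|ne].
    rewrite ltr_wpDr ?subr_ge0 ?subr_gt0 ?psum_lt //; last lia.
    by apply: psum_le => [k|]; [exact: ltW|lia].
  rewrite ltr_wpDl ?subr_ge0 ?subr_gt0 ?psum_lt //; last lia.
  by apply: psum_le => [k|]; [exact: ltW|lia].
apply: (mulfI (lt0r_neq0 N_gt0)); rewrite mulr1 mulr_fsumr.
transitivity (\sum_(c \in corners mu mu')
   (\sum_(k \in `[mu' j + 1, i - 1]) x k * absorb c (k, j) +
    \sum_(k \in `[mu i + 1, j - 1]) y k * absorb c (i, k))).
  by apply: eq_fsbigr => c; rewrite inE => hc; exact: absorb_harmonic.
have fc := finite_corners.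
rewrite fsbig_split // ![\sum_(_ \in corners _ _) \sum_(_ \in _) _]exchange_fsbig //.
congr (_ + _); apply: eq_fsbigr => k; rewrite inE /= in_itv /= => kb.
  rewrite -mulr_fsumr IH ?mulr1 //; try lia.
  by have := @cs_galois _ _ _ _ S k j; lia.
by rewrite -mulr_fsumr IH ?mulr1 //; lia.
Qed.

End absorb.

(** * Moves of the walk *)

Section moves.
Variables (R : realType) (la : seq nat) (x y : int -> R).
Hypothesis la_part : is_partition la.
Hypotheses (x_gt0 : forall i, 0 < x i) (y_gt0 : forall j, 0 < y j).
Let S := partition_shapes la_part.
Local Notation absorb := (absorb x y (lam la) (lam' la)).

Lemma finite_vrange (p : square) : finite_set [set` vrange la p].
Proof. by rewrite /vrange; case: ifP; rewrite ?itv_oo_int ?itv_oc_int. Qed.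

Lemma finite_hrange (p : square) : finite_set [set` hrange la p].
Proof. by rewrite /hrange; case: ifP; rewrite ?itv_oo_int ?itv_oc_int. Qed.

Lemma inD_in10E (p : square) : inD la p || in10 la p = (p.1 <= lam' la p.2).
Proof.
case: p => i j; rewrite /inD /in10 /= (cs_galoisD S).
have := cs_bound' S j; have := @cs_high' _ _ _ _ S j; lia.
Qed.

Lemma inD_in9E (p : square) : inD la p || in9 la p = (p.2 <= lam la p.1).
Proof.
case: p => i j; rewrite /inD /in9 /=.
have := cs_bound S i; have := @cs_high _ _ _ _ S i; lia.
Qed.

(* Vertical moves go down exactly when p.1 <= lam' p.2, and horizontal moves go
   right exactly when p.2 <= lam p.1; the walk never reverses a direction. *)
Definition walk_rank (p : square) : nat :=
  absz ((if p.1 <= lam' la p.2 then len la - p.1 else p.1) +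
        (if p.2 <= lam la p.1 then lam la 1 - p.2 else p.2)).

(** A vertical move changes neither of the two comparisons in [walk_rank], so only the first summand
    changes, and it drops. Both summands are nonnegative, hence [absz] loses nothing. *)
Lemma vrange_rank (p : square) (i : int) : i \in vrange la p ->
  (walk_rank (i, p.2) < walk_rank p)%N.
Proof.
case: p => a b; rewrite /walk_rank /vrange inD_in10E /= => hi.
have hb' := cs_bound' S b; have ha := cs_bound S a.
have e : (i <= lam' la b) = (a <= lam' la b).
  by move: hi; case: ifP => h; rewrite in_itv /= => hi; lia.
have -> : (b <= lam la i) = (b <= lam la a).
  have [b1|b1] := leP 1 b; last by have := cs_bound S i; lia.
  have [a1|a1] := leP 1 a; have [i1|i1] := leP 1 i.
  - by rewrite !(cs_galois S).
  - by move: hi; case: ifP => h; rewrite in_itv /= => hi; lia.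
  - rewrite (cs_galois S) // (cs_low S); last lia.
    have := @cs_high' _ _ _ _ S b; lia.
  - by rewrite !(cs_low S); lia.
rewrite e; move: hi; case: ifP => h; rewrite in_itv /= => hi; case: ifP => h'; lia.
Qed.

Lemma hrange_rank (p : square) (j : int) : j \in hrange la p ->
  (walk_rank (p.1, j) < walk_rank p)%N.
Proof.
case: p => a b; rewrite /walk_rank /hrange inD_in9E /= => hj.
have ha := cs_bound S a; have hb' := cs_bound' S b.
have e : (j <= lam la a) = (b <= lam la a).
  by move: hj; case: ifP => h; rewrite in_itv /= => hj; lia.
have -> : (a <= lam' la j) = (a <= lam' la b).
  have [a1|a1] := leP 1 a; last by have := cs_bound' S j; lia.
  have [b1|b1] := leP 1 b; have [j1|j1] := leP 1 j.
  - by rewrite -!(cs_galois S).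
  - by move: hj; case: ifP => h; rewrite in_itv /= => hj; lia.
  - rewrite -(cs_galois S) // (cs_low' S); last lia.
    have := @cs_high _ _ _ _ S a; lia.
  - by rewrite !(cs_low' S); lia.
rewrite e; move: hj; case: ifP => h; rewrite in_itv /= => hj; case: ifP => h'; lia.
Qed.

Lemma step_nonstop (p q : square) : ~ stopped la p -> step la x y p q =
  ((if (q.2 == p.2) && (q.1 \in vrange la p) then x q.1 else 0) +
   (if (q.1 == p.1) && (q.2 \in hrange la p) then y q.2 else 0)) /
  (\sum_(i \in [set` vrange la p]) x i + \sum_(j \in [set` hrange la p]) y j).
Proof. by move=> nsp; rewrite /step ifF //; apply/asboolP. Qed.

Lemma step_stop (p q : square) : stopped la p -> step la x y p q = (q == p)%:R.
Proof. by move=> sp; rewrite /step ifT //; apply/asboolP. Qed.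

Lemma step_rank (p q : square) : ~ stopped la p -> step la x y p q != 0 ->
  (walk_rank q < walk_rank p)%N.
Proof.
move=> nsp; rewrite step_nonstop //.
case: q => a b /=; case: ifP => [/andP[/eqP -> h] _|_]; first exact: vrange_rank.
case: ifP => [/andP[/eqP -> h] _|_]; first exact: hrange_rank.
by rewrite addr0 mul0r eqxx.
Qed.

Lemma step_ge0 (p q : square) : 0 <= step la x y p q.
Proof.
rewrite /step; case: ifP => _; first by case: (_ == _).
apply: divr_ge0; apply: addr_ge0; try by case: ifP => // _; exact: ltW.
  by apply: fsumr_ge0 => i _; exact: ltW.
by apply: fsumr_ge0 => i _; exact: ltW.
Qed.

Lemma vsum_hsum_gt0 (p : square) : ~ stopped la p ->
  0 < \sum_(i \in [set` vrange la p]) x i + \sum_(j \in [set` hrange la p]) y j.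
Proof.
move=> nsp; have fsum0 (u : int -> R) (A : set int) : (forall i, 0 < u i) ->
    finite_set A -> \sum_(i \in A) u i = 0 -> A = set0.
  move=> u0 fA sA; apply/seteqP; split=> // i Ai; have := u0 i.
  by rewrite (pfsumr_eq0 fA _ sA) ?ltxx // => j _; exact: ltW.
rewrite lt0r addr_ge0 ?andbT; try by apply: fsumr_ge0 => i _; exact: ltW.
rewrite paddr_eq0; try by apply: fsumr_ge0 => i _; exact: ltW.
apply/negP => /andP[/eqP v0 /eqP h0]; apply: nsp; split.
  exact: fsum0 x_gt0 (finite_vrange p) v0.
exact: fsum0 y_gt0 (finite_hrange p) h0.
Qed.

Lemma corner_stopped (c : square) : corners (lam la) (lam' la) c -> stopped la c.
Proof.
case: c => r s [/= r1 s1 e1 e2]; rewrite /stopped /vrange /hrange inD_in10E inD_in9E /=.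
by rewrite e1 e2 !ifF ?itv_oo_int; try lia; split;
  apply/seteqP; split=> k //=; rewrite in_itv /=; lia.
Qed.

(** A stopped square is either an outer corner or lies in D, R9 or R10, where the weight
    vanishes. *)
Lemma absorb_stopped (c p : square) : corners (lam la) (lam' la) c -> stopped la p ->
  absorb c p = (p == c)%:R.
Proof.
move=> hc sp; have [hp|hp] := pselect (corners (lam la) (lam' la) p).
  by rewrite (absorb_corner x y S hc hp).
suff p0 : absorb c p = 0.
  by have [e|//] := eqVneq p c; move: hp; rewrite e.
have [h|h] := leP p.1 (lam' la p.2); first exact: (absorb_col _ _ S hc).
have [h'|h'] := leP p.2 (lam la p.1); first exact: (absorb_row _ _ S hc).
exfalso; apply: hp; case: sp.
rewrite /vrange /hrange inD_in10E inD_in9E !leNgt h h' /= => V H.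
case: p h h' V H => i j /= h h' V H.
(* An empty open range misses in particular [j - 1], which pins the row length; the column is
   treated likewise. *)
have hi : lam la i = j - 1.
  have : ~ `]lam la i, j[%classic (j - 1) by rewrite H.
  by rewrite /= in_itv /=; lia.
have hj : lam' la j = i - 1.
  have : ~ `]lam' la j, i[%classic (i - 1) by rewrite V.
  by rewrite /= in_itv /=; lia.
by have := cs_bound S i; have := cs_bound' S j; split=> //=; lia.
Qed.

(** The four cases are D, R10, R9 and the union of R5 to R8. In the first three both sides are 0, as
    no move leads to a square of positive weight; the last is [absorb_harmonic]. *)
Lemma range_harmonic (c p : square) : corners (lam la) (lam' la) c ->
  (\sum_(i \in [set` vrange la p]) x i + \sum_(j \in [set` hrange la p]) y j) *
    absorb c p =
  \sum_(i \in [set` vrange la p]) x i * absorb c (i, p.2) +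
  \sum_(j \in [set` hrange la p]) y j * absorb c (p.1, j).
Proof.
case: p => a b hc; rewrite /vrange /hrange inD_in10E inD_in9E /=.
have col k j : k <= lam' la j -> absorb c (k, j) = 0.
  by exact: (absorb_col _ _ S hc (p := (k, j))).
have row k j : j <= lam la k -> absorb c (k, j) = 0.
  by exact: (absorb_row _ _ S hc (p := (k, j))).
have [c1 c2 _ _] := hc.
have [h|h] := leP a (lam' la b); have [h'|h'] := leP b (lam la a).
- rewrite col // mulr0 !fsbig1 ?addr0 // => k; rewrite /= in_itv /= => hk.
    by rewrite row ?mulr0 //; lia.
  by rewrite col ?mulr0 //; lia.
- have a0 : a <= 0.
    have := @cs_galois _ _ _ _ S a b; have := cs_bound S a; lia.
  rewrite col // mulr0 !fsbig1 ?addr0 // => k; rewrite /= in_itv /= => hk.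
    by rewrite absorb_low ?mulr0 //; left; exact: le_lt_trans a0 (lt_le_trans ltr01 c1).
  by rewrite col ?mulr0 //; lia.
- have b0 : b <= 0.
    have := @cs_galois _ _ _ _ S a b; have := cs_bound' S b; lia.
  rewrite row // mulr0 !fsbig1 ?addr0 // => k; rewrite /= in_itv /= => hk.
    by rewrite row ?mulr0 //; lia.
  by rewrite absorb_low ?mulr0 //; right; exact: le_lt_trans b0 (lt_le_trans ltr01 c2).
- by rewrite !itv_oo_int; have := absorb_harmonic x_gt0 y_gt0 S hc h' h.
Qed.

End moves.

(** * Countable sums and absorption of the walk *)

Section esum_extra.
Variable R : realType.

Lemma esumZl (T : choiceType) (A : set T) (a : R) (f : T -> \bar R) : 0 <= a ->
  (forall i, 0 <= f i)%E -> (\esum_(i in A) (a%:E * f i) = a%:E * \esum_(i in A) f i)%E.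
Proof.
move=> a0 f0; rewrite /esum -ereal_supZl //.
  congr ereal_sup; apply/seteqP; split=> z /=.
    move=> [F FA <-]; exists (\sum_(i \in F) f i)%E; first by exists F.
    by rewrite ge0_mule_fsumr.
  by move=> [_ [F FA <-] <-]; exists F; rewrite // ge0_mule_fsumr.
apply/set0P; exists (\sum_(i \in set0) f i)%E; exists set0 => //.
exact: fsets_set0.
Qed.

Lemma esum_fin_fset (T : choiceType) (A : set T) (f : T -> R) : finite_set A ->
  (forall i, A i -> 0 <= f i) ->
  (\esum_(i in A) (f i)%:E = (\sum_(i \in A) f i)%:E)%E.
Proof.
move=> fA f0; rewrite esum_fset ?fsumEFin // => i; rewrite inE => Ai.
by rewrite lee_fin f0.
Qed.

(** Tonelli for a product of one-variable families; it factors the sums over rectangular regions. *)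
Lemma esum_setX (T1 T2 : choiceType) (A : set T1) (B : set T2) (u : T1 -> R)
    (v : T2 -> R) (U V : R) :
  (forall i, 0 <= u i) -> (forall j, 0 <= v j) ->
  (\esum_(i in A) (u i)%:E = U%:E)%E -> (\esum_(j in B) (v j)%:E = V%:E)%E ->
  (\esum_(p in A `*` B) (u p.1 * v p.2)%:E = (U * V)%:E)%E.
Proof.
move=> u0 v0 eU eV.
have -> : A `*` B = A `*`` (fun=> B) by apply/seteqP; split=> [[i j]|[i j]] /= [].
rewrite -(esum_esum (a := fun i j => (u i * v j)%:E)); last first.
  by move=> i j _ _; rewrite lee_fin mulr_ge0.
transitivity (\esum_(i in A) (V%:E * (u i)%:E))%E.
  apply: eq_esum => i _; under eq_esum do rewrite EFinM.
  by rewrite esumZl // eV muleC.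
rewrite esumZl ?eU -?EFinM 1?mulrC // -lee_fin -eV.
by apply: esum_ge0 => j _; rewrite lee_fin.
Qed.

Lemma measure_preimage (d : measure_display) (T : measurableType d)
    (mu : {measure set T -> \bar R}) (U : countType) (f : T -> U)
    (A : set U) (B : set T) :
  (forall u, measurable (f @^-1` [set u])) -> measurable B ->
  mu (B `&` f @^-1` A) = (\esum_(u in A) mu (B `&` f @^-1` [set u]))%E.
Proof.
move=> mf mB.
pose F n := if (pickle_inv n : option U) is Some u then f @^-1` [set u] else set0.
have mF n : measurable (F n) by rewrite /F; case: pickle_inv.
have FA : f @^-1` A = \bigcup_(n in pickle @` A) F n.
  apply/seteqP; split=> t /=.
    by move=> At; exists (pickle (f t)); [exists (f t)|rewrite /F pickleK_inv].
  by move=> [_ [u Au <-]]; rewrite /F pickleK_inv /= => ->.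
rewrite FA setI_bigcupr measure_bigcup.
- rewrite nneseries_esum // set_mem_set esum_image; last first.
    by move=> u v _ _; apply: (pcan_inj (@pickleK_inv U)).
  by apply: eq_esum => u _; rewrite /F pickleK_inv.
- by move=> i _; exact: measurableI.
- apply/trivIsetP => _ _ [u _ <-] [v _ <-] uv; rewrite /F !pickleK_inv.
  apply/seteqP; split=> t //= [[_ fu] [_ fv]].
  by move: uv; rewrite -fu -fv eqxx.
Qed.

End esum_extra.

Section step_expectation.
Variables (R : realType) (la : seq nat) (x y : int -> R).
Hypotheses (x_gt0 : forall i, 0 < x i) (y_gt0 : forall j, 0 < y j).

(** The one-step expectation of [phi], scaled by [a], which will be the weight of a path. The
    transition law is a vertical plus a horizontal term, each supported on the image of a finite
    range. *)
Lemma esum_step (p : square) (a : R) (phi : square -> R) : ~ stopped la p ->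
  0 <= a -> (forall q, 0 <= phi q) ->
  (\esum_(q in [set: square]) (a * (step la x y p q * phi q))%:E =
   (a * ((\sum_(i \in [set` vrange la p]) x i * phi (i, p.2) +
          \sum_(j \in [set` hrange la p]) y j * phi (p.1, j)) /
         (\sum_(i \in [set` vrange la p]) x i +
          \sum_(j \in [set` hrange la p]) y j)))%:E)%E.
Proof.
move=> nsp a0 phi0; set N := _ + \sum_(j \in _) y j.
have N0 : 0 <= N by apply: ltW; exact: vsum_hsum_gt0.
pose b := a / N; have b0 : 0 <= b by exact: divr_ge0.
pose V := (fun i => (i, p.2)) @` [set` vrange la p].
pose H := (fun j => (p.1, j)) @` [set` hrange la p].
have inV q : (q \in V) = (q.2 == p.2) && (q.1 \in vrange la p).
  apply/idP/andP; rewrite inE.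
    by move=> [i iv <-].
  by case: q => q1 q2 /= [/eqP -> iv]; exists q1.
have inH q : (q \in H) = (q.1 == p.1) && (q.2 \in hrange la p).
  apply/idP/andP; rewrite inE.
    by move=> [i iv <-].
  by case: q => q1 q2 /= [/eqP -> iv]; exists q2.
transitivity (\esum_(q in [set: square])
   ((if q \in V then (b * (x q.1 * phi q))%:E else 0) +
    (if q \in H then (b * (y q.2 * phi q))%:E else 0)))%E.
  apply: eq_esum => q _; rewrite step_nonstop // -/N inV inH /b.
  by case: ifP => _; case: ifP => _; rewrite ?adde0 ?add0e -?EFinD;
    congr EFin; ring.
have bpos (u : R) q : 0 < u -> 0 <= b * (u * phi q).
  by move=> u0; apply: mulr_ge0 => //; apply: mulr_ge0 => //; exact: ltW.
rewrite esumD; try by move=> q _; case: ifP => // _; rewrite lee_fin bpos.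
rewrite -!esum_mkcond !esum_image; try by move=> i j _ _ [].
rewrite !esum_fin_fset; try by [apply: finite_vrange|apply: finite_hrange];
  try by move=> i _; exact: bpos.
by rewrite -EFinD -!mulr_fsumr -mulrDr; congr EFin; rewrite /b; ring.
Qed.

End step_expectation.

(** * Cylinder events and absorption of the random walk *)

Section walk.
Variables (R : realType) (la : seq nat) (x y : int -> R).
Hypothesis la_part : is_partition la.
Hypotheses (x_gt0 : forall i, 0 < x i) (y_gt0 : forall j, 0 < y j).
Variables (d : measure_display) (T : measurableType d) (P : probability T R).
Variable W : nat -> T -> square.
Hypothesis HW : hook_walk la x y P W.
Variable c : square.
Hypothesis c_corner : corners (lam la) (lam' la) c.
Let S := partition_shapes la_part.
Local Notation absorb := (absorb x y (lam la) (lam' la)).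

Definition cylinder (n : nat) (p : nat -> square) : set T :=
  \bigcap_(k in [set k : nat | (k <= n)%N]) (W k @^-1` [set p k]).

Definition path_weight (n : nat) (p : nat -> square) : R :=
  start x y (p 0%N) * \prod_(k < n) step la x y (p k) (p k.+1).

Lemma cylinder_weight (n : nat) (p : nat -> square) :
  P (cylinder n p) = (path_weight n p)%:E.
Proof. exact: hook_walk_law HW n p. Qed.

Lemma measurable_cylinder (n : nat) (p : nat -> square) : measurable (cylinder n p).
Proof.
apply: bigcap_measurable; first by exists 0%N.
by move=> k _; exact: hook_walk_measurable HW k (p k).
Qed.

Lemma start_ge0 (q : square) : 0 <= start x y q.
Proof.
have tsum_ge0 (u : int -> R) A : (forall i, 0 < u i) -> 0 <= tsum u A.
  by move=> u0; apply/fine_ge0/esum_ge0 => i _; rewrite lee_fin ltW.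
by apply: divr_ge0; apply: mulr_ge0; try exact: ltW; exact: tsum_ge0.
Qed.

Lemma path_weight_ge0 (n : nat) (p : nat -> square) : 0 <= path_weight n p.
Proof.
apply: mulr_ge0; first exact: start_ge0.
by apply: prodr_ge0 => k _; exact: step_ge0.
Qed.

(** The value [q] is kept at all times after [n], so that taking [q = p n] also describes a walk
    that has stopped. *)
Definition extend (n : nat) (p : nat -> square) (q : square) (k : nat) : square :=
  if (k <= n)%N then p k else q.

Lemma cylinder_extend (n : nat) (p : nat -> square) (q : square) :
  cylinder n p `&` W n.+1 @^-1` [set q] = cylinder n.+1 (extend n p q).
Proof.
apply/seteqP; split=> t; rewrite /cylinder /extend /=.
  move=> [tp tq] k /=; rewrite leq_eqVlt ltnS => /predU1P[->|kn].
    by rewrite ltnn.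
  by rewrite kn; exact: tp.
move=> tp; split; last by have := tp n.+1 (leqnn _); rewrite ltnn.
by move=> k /= kn; have := tp k (leqW kn); rewrite /= kn.
Qed.

Lemma path_weight_extend (n m : nat) (p : nat -> square) (q : square) :
  path_weight (n + m).+1 (extend n p q) =
  path_weight (n + m) (extend n p q) * step la x y (extend n p q (n + m)) q.
Proof.
rewrite /path_weight big_ord_recr mulrA /=; congr (_ * step _ _ _ _ _).
by rewrite /extend ifF //; lia.
Qed.

Lemma path_weight_extend0 (n : nat) (p : nat -> square) (q : square) :
  path_weight n (extend n p q) = path_weight n p.
Proof.
rewrite /path_weight; congr (_ * _); apply: eq_bigr => k _.
by rewrite /extend !ifT //; have := ltn_ord k; lia.
Qed.

Lemma ends_atE : ends_at la W c = \bigcup_n (W n @^-1` [set c]).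
Proof.
apply/seteqP; split=> t /=; first by move=> [_ [n tn]]; exists n.
by move=> [n _ tn]; split; [exact: (corner_stopped la_part c_corner)|exists n].
Qed.

Lemma measurable_ends_at : measurable (ends_at la W c).
Proof.
rewrite ends_atE; apply: bigcup_measurable => n _.
exact: hook_walk_measurable HW n c.
Qed.

(** The event [B] of staying at [p n] has the full probability of the cylinder, since each further
    step has probability 1. A visit to [c] lies in the null complement of [B]. *)
Lemma cylinder_stuck (n m : nat) (p : nat -> square) : stopped la (p n) -> p n != c ->
  P (cylinder n p `&` W (n + m).+1 @^-1` [set c]) = 0%E.
Proof.
move=> sp pc; set B := cylinder (n + m).+1 (extend n p (p n)).
have PB : P B = P (cylinder n p).
  rewrite /B !cylinder_weight -addnS; congr EFin.
  elim: m.+1 => [|k IH]; first by rewrite addn0 path_weight_extend0.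
  rewrite addnS path_weight_extend IH.
  have -> : extend n p (p n) (n + k) = p n.
    by rewrite /extend; case: ifP => // h; congr p; lia.
  by rewrite step_stop // eqxx mulr1.
have mB : measurable B by exact: measurable_cylinder.
have mC := measurable_cylinder n p.
have mW := hook_walk_measurable HW (n + m).+1 c.
have BC : B `<=` cylinder n p.
  move=> t tB k /= kn; have := tB k; rewrite /extend /= kn.
  by apply; rewrite /=; lia.
have D0 : (P (cylinder n p `\` B) = P (cylinder n p) - P (cylinder n p `&` B))%E.
  by apply: measureD => //; exact: le_lt_trans (probability_le1 P mC) (ltry 1).
rewrite (setIidr BC) PB cylinder_weight subee // in D0.
apply/eqP; rewrite eq_le measure_ge0 andbT.
rewrite -D0.
apply: le_measure; rewrite ?inE; [exact: measurableI|exact: measurableD|].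
move=> t [tp tc]; split=> // /(_ (n + m).+1 (leqnn _)).
by rewrite /= tc /extend ifF; [move=> e; rewrite e eqxx in pc|lia].
Qed.

(* The induction is on the rank of the last square; the hypothesis excludes the
   null cylinders of paths that pass through c and leave it. *)
Lemma absorb_cylinder (n : nat) (p : nat -> square) :
  (forall k, (k < n)%N -> ~ stopped la (p k)) ->
  P (cylinder n p `&` ends_at la W c) = (path_weight n p * absorb c (p n))%:E.
Proof.
have [N] := ubnP (walk_rank la (p n)); elim: N n p => // N IH n p pN nsp.
have [sp|np] := pselect (stopped la (p n)).
  rewrite (absorb_stopped x y la_part c_corner sp).
  have [pc|pc] := eqVneq (p n) c.
    rewrite mulr1 setIidl ?cylinder_weight // => t tp.
    by rewrite ends_atE; exists n => //=; rewrite -pc; exact: (tp n (leqnn n)).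
  rewrite mulr0 ends_atE setI_bigcupr.
  apply/(measure_negligible (mu := P)).
    apply: bigcup_measurable => k _; apply: measurableI.
      exact: measurable_cylinder.
    exact: hook_walk_measurable HW k c.
  (* A visit at time [k <= n] would mean [p k = c], excluded by [pc] if [k = n] and by [nsp] if
     [k < n]; later visits are null by [cylinder_stuck]. *)
  apply: negligible_bigcup => k; have [kn|nk] := leqP k n.
    rewrite (_ : _ `&` _ = set0); first exact: negligible_set0.
    apply/seteqP; split=> t //= [tp tc].
    have pk : p k = c by rewrite -tc; symmetry; exact: (tp k kn).
    move: kn; rewrite leq_eqVlt => /predU1P[kn|kn]; first by rewrite -kn pk eqxx in pc.
    by apply: (nsp k kn); rewrite pk; exact: (corner_stopped la_part c_corner).
  exists (cylinder n p `&` W k @^-1` [set c]); split=> //.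
    apply: measurableI; first exact: measurable_cylinder.
    exact: hook_walk_measurable HW k c.
  have -> : k = (n + (k - n.+1)).+1 by lia.
  exact: cylinder_stuck.
have Wm q : measurable (W n.+1 @^-1` [set q]) by exact: hook_walk_measurable HW n.+1 q.
have mB := measurableI _ _ (measurable_cylinder n p) measurable_ends_at.
have -> : (P (cylinder n p `&` ends_at la W c) =
    \esum_(q in [set: square])
      P (cylinder n p `&` ends_at la W c `&` W n.+1 @^-1` [set q]))%E.
  by have := measure_preimage P setT Wm mB; rewrite preimage_setT setIT.
transitivity (\esum_(q in [set: square])
   (path_weight n p * (step la x y (p n) q * absorb c q))%:E)%E.
  apply: eq_esum => q _; rewrite setIAC cylinder_extend.
  have w : path_weight n.+1 (extend n p q) = path_weight n p * step la x y (p n) q.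
    by have := path_weight_extend n 0 p q;
      rewrite addn0 path_weight_extend0 /extend leqnn.
  (* A transition of probability 0 need not lower the rank, but its cylinder is null. The induction
     hypothesis serves the other transitions. *)
  have [s0|s0] := eqVneq (step la x y (p n) q) 0.
    rewrite s0 mul0r mulr0; apply/eqP; rewrite eq_le measure_ge0 andbT.
    apply: (@le_trans _ _ (P (cylinder n.+1 (extend n p q)))); last first.
      by rewrite cylinder_weight w s0 mulr0.
    apply: le_measure; rewrite ?inE.
    - by apply: measurableI; [exact: measurable_cylinder|exact: measurable_ends_at].
    - exact: measurable_cylinder.
    - exact: subIsetl.
  have eq : extend n p q n.+1 = q by rewrite /extend ltnn.
  rewrite IH ?w ?eq ?mulrA //.
    have := step_rank la_part np s0; lia.
  move=> k; rewrite ltnS => kn; rewrite /extend kn.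
  by move: kn; rewrite leq_eqVlt => /predU1P[->//|]; exact: nsp.
rewrite (esum_step x_gt0 y_gt0) //.
- rewrite -(range_harmonic la_part x_gt0 y_gt0) //; congr (_ * _)%:E.
  rewrite mulrAC divff ?mul1r //.
  by rewrite gt_eqF // vsum_hsum_gt0.
- exact: path_weight_ge0.
- by move=> q; exact: (absorb_ge0 x_gt0 y_gt0 S q c_corner).
Qed.

Lemma cylinder0 (a : square) : cylinder 0 (fun=> a) = W 0 @^-1` [set a].
Proof.
apply/seteqP; split=> t /=; first by move=> /(_ 0%N (leqnn _)).
by move=> ta k /=; rewrite leqn0 => /eqP ->.
Qed.

Lemma path_weight0 (a : square) : path_weight 0 (fun=> a) = start x y a.
Proof. by rewrite /path_weight big_ord0 mulr1. Qed.

Lemma measure_start (A : set square) :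
  P (W 0%N @^-1` A) = (\esum_(a in A) (start x y a)%:E)%E.
Proof.
have -> : (P (W 0%N @^-1` A) = \esum_(a in A) P (W 0%N @^-1` [set a]))%E.
  have := measure_preimage P A (hook_walk_measurable HW 0) measurableT.
  by rewrite setTI => ->; apply: eq_esum => a _; rewrite setTI.
by apply: eq_esum => a _; rewrite -cylinder0 cylinder_weight path_weight0.
Qed.

(** The case of cylinders of length 0, where no earlier square exists and the hypothesis of
    [absorb_cylinder] is vacuous. *)
Lemma measure_start_ends_at (A : set square) :
  P (ends_at la W c `&` W 0%N @^-1` A) =
  (\esum_(a in A) (start x y a * absorb c a)%:E)%E.
Proof.
have -> : (P (ends_at la W c `&` W 0%N @^-1` A) =
    \esum_(a in A) P (ends_at la W c `&` W 0%N @^-1` [set a]))%E.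
  exact: (measure_preimage P A (hook_walk_measurable HW 0) measurable_ends_at).
apply: eq_esum => a _; rewrite setIC -cylinder0 absorb_cylinder //.
by rewrite path_weight0.
Qed.

End walk.

(** * The five formulas *)

Section formulas.
Variables (R : realType) (la : seq nat) (x y : int -> R).
Hypothesis la_part : is_partition la.
Hypotheses (x_gt0 : forall i, 0 < x i) (y_gt0 : forall j, 0 < y j).
Let S := partition_shapes la_part.
Let S' := conjugate_shapesC S.
Local Notation absorb := (absorb x y (lam la) (lam' la)).
Local Notation l := (len la).
Local Notation m := (lam la 1).
Local Notation wx c := (row_weight x y (lam la) c.1 c.2).
Local Notation wy c := (row_weight y x (lam' la) c.2 c.1).

Lemma outer_cornersE : outer_corner la = corners (lam la) (lam' la).
Proof. by apply/seteqP; split=> [[r s]|[r s]] /outer_cornerP; apply. Qed.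

Lemma finite_R5 : finite_set (R5 la).
Proof.
apply: (@sub_finite_set _ _ (`[1, l]%classic `*` `[1, m]%classic)).
  by move=> [i j] [/= hi hj _]; split; rewrite /= in_itv.
exact: finite_setX.
Qed.

Lemma R5_bound (e : square) : R5 la e -> [/\ 1 <= e.1, 1 <= e.2 & lam la e.1 < e.2].
Proof.
move=> [/andP[e1 h1] /andP[e2 h2] nd]; split=> //; rewrite ltNge; apply/negP => h.
by apply: nd; rewrite /diagram /= e1 h1 e2.
Qed.

Section one_corner.
Variable c : square.
Hypothesis hc : corners (lam la) (lam' la) c.

(** The product over columns is the row factor below the diagram; the product over rows is, by
    transposition, the column factor to its right. *)
Lemma hook_prodE : hook_prod la x y c = wx c (l + 1) * wy c (m + 1).
Proof.
rewrite mulrC -(row_weight_prod x_gt0 y_gt0 S hc).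
rewrite -(row_weight_prod y_gt0 x_gt0 S' (cornerC hc)).
case: c => r s; congr (_ * _); apply: eq_fsbigr => i _.
by rewrite [X in _ / X]addrC.
Qed.

Lemma sum_wx : \sum_(i \in `[1, l]) x i * wx c i =
  (\sum_(k \in `[c.1, l]) x k + \sum_(k \in `[1, c.2 - 1]) y k) * wx c (l + 1).
Proof.
have /andP[? ?] := corner_bound S hc.
by rewrite -(slack_last x y S hc) -(sum_row_weight x_gt0 y_gt0 S hc (b := 1)) ?addrK.
Qed.

Lemma sum_wy : \sum_(j \in `[1, m]) y j * wy c j =
  (\sum_(k \in `[1, c.1 - 1]) x k + \sum_(k \in `[c.2, m]) y k) * wy c (m + 1).
Proof.
have hc' := cornerC hc; have /andP[? ?] := corner_bound S' hc'.
rewrite [X in X * _]addrC -(slack_last y x S' hc').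
by rewrite -(sum_row_weight y_gt0 x_gt0 S' hc' (b := 1)) ?addrK.
Qed.

(** Since [absorb c] vanishes on the diagram, the sum over R5 extends to the full rectangle, where
    it factors into [sum_wx] and [sum_wy]. *)
Lemma formula5E : formula5 la x y c =
  (\sum_(e \in R5 la) x e.1 * y e.2 * absorb c e) / \sum_(e \in R5 la) (x e.1 * y e.2).
Proof.
have -> : \sum_(e \in R5 la) x e.1 * y e.2 * absorb c e =
    \sum_(e \in `[1, l] `*` `[1, m]) x e.1 * y e.2 * absorb c e.
  apply: fsbig_widen => [[i j] [/= hi hj _]|[i j] /= [[]]].
    by split; rewrite /= in_itv.
  rewrite !in_itv /= => hi hj nR; apply/eqP.
  rewrite (absorb_row _ _ S hc) ?mulr0 //= leNgt; apply/negP => h.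
  apply: nR; split=> //= -[_ /andP[_]] /=; rewrite leNgt h //.
transitivity ((\sum_(i \in `[1, l]) x i * wx c i) *
    (\sum_(j \in `[1, m]) y j * wy c j) / \sum_(e \in R5 la) (x e.1 * y e.2)).
  rewrite sum_wx sum_wy; have := hook_prodE; move: hc; case: c => r s _ /= e.
  by rewrite /formula5 e; ring.
congr (_ / _); rewrite mulr_fsuml.
under eq_fsbigr do rewrite mulr_fsumr.
rewrite pair_fsbig //; apply: eq_fsbigr => e _.
by rewrite /absorb; ring.
Qed.

(** Column [m + 1] represents all of R6, as the column factor is constant to the right of the
    diagram. The formula thus becomes an average of absorption probabilities. *)
Lemma formula6E : formula6 la x y c =
  (\sum_(i \in `[1, l]) x i * absorb c (i, m + 1)) / \sum_(i \in `[1, l]) x i.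
Proof.
under eq_fsbigr do rewrite /absorb /= mulrA.
rewrite -mulr_fsuml sum_wx; have := hook_prodE; move: hc; case: c => r s _ /= e.
by rewrite /formula6 e; ring.
Qed.

Lemma formula7E : formula7 la x y c =
  (\sum_(j \in `[1, m]) y j * absorb c (l + 1, j)) / \sum_(j \in `[1, m]) y j.
Proof.
under eq_fsbigr do rewrite /absorb /= mulrCA.
rewrite -mulr_fsumr sum_wy; have := hook_prodE; move: hc; case: c => r s _ /= e.
by rewrite /formula7 e; ring.
Qed.

Lemma formula8E : formula8 la x y c = absorb c (l + 1, m + 1).
Proof. exact: hook_prodE. Qed.

End one_corner.

(** After exchanging the sums, [sum_absorb] gives 1 for each square, hence for their weighted
    average. *)
Lemma sum_absorb_average (I : choiceType) (A : set I) (u : I -> R) (p : I -> square) :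
  finite_set A -> A !=set0 -> (forall i, 0 < u i) ->
  (forall i, A i -> [/\ 1 <= (p i).1, 1 <= (p i).2 & lam la (p i).1 < (p i).2]) ->
  \sum_(c \in outer_corner la)
    (\sum_(i \in A) u i * absorb c (p i)) / (\sum_(i \in A) u i) = 1.
Proof.
move=> fA [i0 Ai0] u0 hp; rewrite -mulr_fsuml outer_cornersE.
have fc := finite_corners S.
rewrite exchange_fsbig //.
have -> : \sum_(i \in A) \sum_(c \in corners (lam la) (lam' la)) u i * absorb c (p i) =
    \sum_(i \in A) u i.
  apply: eq_fsbigr => i; rewrite inE => /hp; case: (p i) => a b [/= a1 b1 ab].
  by rewrite -mulr_fsumr (sum_absorb x_gt0 y_gt0 S) ?mulr1.
rewrite divff // gt_eqF // (fsbigD1 i0) //= ltr_wpDr //.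
by apply: fsumr_ge0 => i _; exact: ltW.
Qed.

Lemma sum_formula5 : R5 la !=set0 -> \sum_(c \in outer_corner la) formula5 la x y c = 1.
Proof.
move=> R50; rewrite -(sum_absorb_average (p := id) finite_R5 R50
  (u := fun e => x e.1 * y e.2)); last exact: R5_bound.
  by apply: eq_fsbigr => c; rewrite outer_cornersE inE => /formula5E.
by move=> e; exact: mulr_gt0.
Qed.

Lemma sum_formula6 : R6 la !=set0 -> \sum_(c \in outer_corner la) formula6 la x y c = 1.
Proof.
move=> [[i j] [/= hi hj]].
rewrite -(sum_absorb_average (p := fun i => (i, m + 1))
  (finite_itv_int 1 l) _ x_gt0) //.
- by apply: eq_fsbigr => c; rewrite outer_cornersE inE => /formula6E.
- by exists i; rewrite /= in_itv.
- move=> k /=; rewrite in_itv /= => /andP[k1 _].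
  by have := cs_bound S k; split=> //; lia.
Qed.

Lemma sum_formula7 : R7 la !=set0 -> \sum_(c \in outer_corner la) formula7 la x y c = 1.
Proof.
move=> [[i j] [/= hi hj]].
rewrite -(sum_absorb_average (p := fun j => (l + 1, j))
  (finite_itv_int 1 m) _ y_gt0) //.
- by apply: eq_fsbigr => c; rewrite outer_cornersE inE => /formula7E.
- by exists j; rewrite /= in_itv.
- move=> k /=; rewrite in_itv /= => /andP[k1 _].
  by rewrite (cs_high S); [split=> //; have := len_ge0 la; lia|lia].
Qed.

Lemma sum_formula8 : \sum_(c \in outer_corner la) formula8 la x y c = 1.
Proof.
have m0 := (cs_ge0 S).2; have l0 := len_ge0 la.
rewrite -[RHS](sum_absorb x_gt0 y_gt0 S (i := l + 1) (j := m + 1)); try lia.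
  rewrite outer_cornersE; apply: eq_fsbigr => c; rewrite inE; exact: formula8E.
by rewrite (cs_high S); lia.
Qed.

End formulas.

(** * Sums over rays and over the whole line *)

Section tsums.
Variable R : realType.

(** [tsum] applies [fine], which would turn an infinite sum into 0; summability excludes this. *)
Lemma esum_tsum (u : int -> R) (A : set int) : (forall i, 0 < u i) ->
  summable [set: int] (fun i => (u i)%:E) ->
  (\esum_(i in A) (u i)%:E = (tsum u A)%:E)%E.
Proof.
move=> u0 su; rewrite /tsum fineK // ge0_fin_numE; last first.
  by apply: esum_ge0 => i _; rewrite lee_fin ltW.
apply: le_lt_trans su; rewrite esum_mkcond; apply: le_esum => i _.
by case: ifP => // _; rewrite gee0_abs // lee_fin ltW.
Qed.

Lemma esum_ray (u : int -> R) (a b : int) : (forall i, 0 <= u i) -> a <= b + 1 ->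
  (\esum_(i in `[a, +oo[) (u i)%:E =
   (\sum_(i \in `[a, b]) u i)%:E + \esum_(i in `[(b + 1)%R, +oo[) (u i)%:E)%E.
Proof.
move=> u0 ab; have e1 : `[a, +oo[ `&` `[a, b] = `[a, b]%classic.
  by apply/seteqP; split=> i /=; rewrite !in_itv /=; lia.
have e2 : `[a, +oo[ `&` ~` `[a, b] = `[(b + 1)%R, +oo[%classic.
  by apply/seteqP; split=> i /=; rewrite !in_itv /=; lia.
rewrite (esumID `[a, b]%classic) ?e1 ?e2; last by move=> i _; rewrite lee_fin.
by congr (_ + _)%E; rewrite esum_fin_fset.
Qed.

Lemma tsum_gt0 (u : int -> R) (A : set int) : (forall i, 0 < u i) ->
  summable [set: int] (fun i => (u i)%:E) -> A !=set0 -> 0 < tsum u A.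
Proof.
move=> u0 su [i Ai]; rewrite -lte_fin -esum_tsum //.
apply: (@lt_le_trans _ _ (u i)%:E); first by rewrite lte_fin.
rewrite (esumID [set i]); last by move=> j _; rewrite lee_fin ltW.
rewrite setI1 mem_set // esum_set1; last by rewrite lee_fin ltW.
by rewrite leeDl //; apply: esum_ge0 => j _; rewrite lee_fin ltW.
Qed.

Lemma tsum_fin (u : int -> R) (A : set int) : (forall i, 0 < u i) -> finite_set A ->
  tsum u A = \sum_(i \in A) u i.
Proof. by move=> u0 fA; rewrite /tsum esum_fin_fset // => i _; exact: ltW. Qed.

Variables (x y : int -> R).
Hypotheses (x_gt0 : forall i : int, 0 < x i) (y_gt0 : forall j : int, 0 < y j).
Hypotheses (x_sum : summable [set: int] (fun i => (x i)%:E))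
  (y_sum : summable [set: int] (fun j => (y j)%:E)).

Lemma total_gt0 : 0 < tsum x setT * tsum y setT.
Proof. by apply: mulr_gt0; apply: tsum_gt0 => //; exists 0. Qed.

Lemma esum_start_rect (I J : set int) (f g : int -> R) (U V : R) :
  (forall i, 0 <= f i) -> (forall j, 0 <= g j) ->
  (\esum_(i in I) (x i * f i)%:E = U%:E)%E ->
  (\esum_(j in J) (y j * g j)%:E = V%:E)%E ->
  (\esum_(a in I `*` J) (start x y a * (f a.1 * g a.2))%:E =
   (U * V / (tsum x setT * tsum y setT))%:E)%E.
Proof.
move=> f0 g0 eU eV; set Z := tsum x _ * _.
transitivity (\esum_(a in I `*` J)
    (Z^-1)%:E * ((x a.1 * f a.1) * (y a.2 * g a.2))%:E)%E.
  by apply: eq_esum => a _; rewrite -EFinM /start -/Z; congr EFin; ring.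
have xf0 i : 0 <= x i * f i by apply: mulr_ge0 => //; exact: ltW.
have yg0 j : 0 <= y j * g j by apply: mulr_ge0 => //; exact: ltW.
rewrite esumZl; first by rewrite (esum_setX xf0 yg0 eU eV) -EFinM mulrC.
  by rewrite invr_ge0 ltW // total_gt0.
by move=> a; rewrite lee_fin mulr_ge0.
Qed.

End tsums.

Section row_sums.
Variables (R : realType) (x y : int -> R).
Hypotheses (x_gt0 : forall i : int, 0 < x i) (y_gt0 : forall j : int, 0 < y j).
Hypothesis x_sum : summable [set: int] (fun i => (x i)%:E).
Variables (l m : int) (mu mu' : int -> int) (r s : int).
Hypothesis S : conjugate_shapes l m mu mu'.
Hypothesis rs : corner mu mu' r s.
Local Notation w := (row_weight x y mu r s).

Lemma esum_row_weight_high (A : set int) : A `<=` `[l + 1, +oo[ ->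
  (\esum_(i in A) (x i * w i)%:E = (tsum x A * w (l + 1))%:E)%E.
Proof.
move=> hA; rewrite mulrC EFinM -esum_tsum // -esumZl.
- apply: eq_esum => i /hA; rewrite /= in_itv /= andbT => li.
  rewrite (row_weight_const x_gt0 y_gt0 S rs); last lia.
  by rewrite -EFinM mulrC.
- exact: (row_weight_ge0 x_gt0 y_gt0 S rs).
- by move=> i; rewrite lee_fin ltW.
Qed.

Lemma esum_row_weight_low :
  (\esum_(i in `[1%R, l]) (x i * w i)%:E =
   ((\sum_(k \in `[r, l]) x k + \sum_(k \in `[1, s - 1]) y k) * w (l + 1))%:E)%E.
Proof.
have w0 := row_weight_ge0 x_gt0 y_gt0 S rs; have /andP[? ?] := corner_bound S rs.
rewrite esum_fin_fset //; last by move=> i _; apply: mulr_ge0 => //; exact: ltW.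
by rewrite -(slack_last x y S rs) -(sum_row_weight x_gt0 y_gt0 S rs (b := 1)) ?addrK.
Qed.

(** The rows up to 0 contribute nothing. The rows 1 to [l] and those beyond both produce the factor
    [w (l + 1)], and x_r + ... + x_l joins the tail to form the sum from [r] on. *)
Lemma esum_row_weight :
  (\esum_(i in [set: int]) (x i * w i)%:E =
   ((tsum x `[r, +oo[ + \sum_(k \in `[1, s - 1]) y k) * w (l + 1))%:E)%E.
Proof.
have w0 := row_weight_ge0 x_gt0 y_gt0 S rs; have /andP[r1 rl] := corner_bound S rs.
have xw0 i : 0 <= x i * w i by apply: mulr_ge0 => //; exact: ltW.
have l0 := (cs_ge0 S).1.
transitivity (\esum_(i in `[1%R, +oo[) (x i * w i)%:E)%E.
  rewrite [RHS]esum_mkcond; apply: eq_esum => i _; case: ifPn => //.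
  rewrite notin_setE /= in_itv /= andbT => /negP i1.
  by rewrite row_weight0 ?mulr0 //; lia.
rewrite (esum_ray (b := l)) //; last lia.
rewrite -esum_fin_fset // esum_row_weight_low esum_row_weight_high //.
rewrite -EFinD -mulrDl; congr (_ * _)%:E; rewrite addrAC; congr (_ + _).
apply: EFin_inj; rewrite EFinD -!esum_tsum // (esum_ray (a := r) (b := l)) //.
by move=> i; exact: ltW.
Qed.

End row_sums.

(** * Conditional and total probabilities of ending in a corner *)

Section walk_formulas.
Variables (R : realType) (la : seq nat) (x y : int -> R).
Hypothesis la_part : is_partition la.
Hypotheses (x_gt0 : forall i : int, 0 < x i) (y_gt0 : forall j : int, 0 < y j).
Hypotheses (x_sum : summable [set: int] (fun i => (x i)%:E))
  (y_sum : summable [set: int] (fun j => (y j)%:E)).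
Let S := partition_shapes la_part.
Let S' := conjugate_shapesC S.
Variables (d : measure_display) (T : measurableType d) (P : probability T R).
Variable W : nat -> T -> square.
Hypothesis HW : hook_walk la x y P W.
Variable c : square.
Hypothesis hc : corners (lam la) (lam' la) c.
Local Notation Z := (tsum x setT * tsum y setT).
Local Notation absorb := (absorb x y (lam la) (lam' la)).
Local Notation l := (len la).
Local Notation m := (lam la 1).
Local Notation wx := (row_weight x y (lam la) c.1 c.2).
Local Notation wy := (row_weight y x (lam' la) c.2 c.1).

(** The starting law and the absorption probability are both products of a row and a column term.
    The total mass cancels, leaving an average over rows times one over columns. *)
Lemma cprob_rect (I J : set int) (U V : R) : I !=set0 -> J !=set0 ->
  (\esum_(i in I) (x i * wx i)%:E = U%:E)%E ->
  (\esum_(j in J) (y j * wy j)%:E = V%:E)%E ->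
  cprob P (ends_at la W c) (W 0%N @^-1` (I `*` J)) =
  (U / tsum x I) * (V / tsum y J).
Proof.
move=> I0 J0 eU eV; rewrite /cprob.
rewrite (measure_start_ends_at la_part x_gt0 y_gt0 HW hc) (measure_start HW).
rewrite (esum_start_rect x_gt0 y_gt0 x_sum y_sum _ _ eU eV); last first.
- exact: (row_weight_ge0 y_gt0 x_gt0 S' (cornerC hc)).
- exact: (row_weight_ge0 x_gt0 y_gt0 S hc).
have -> : (\esum_(a in I `*` J) (start x y a)%:E =
    (tsum x I * tsum y J / Z)%:E)%E.
  (* The probability of starting in the rectangle is the same sum with both weights equal to 1. *)
  rewrite -(esum_start_rect x_gt0 y_gt0 x_sum y_sum (I := I) (J := J)
    (f := cst 1) (g := cst 1)) //.
  - by apply: eq_esum => a _; rewrite !mulr1.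
  - by rewrite -esum_tsum //; apply: eq_esum => a _; rewrite mulr1.
  - by rewrite -esum_tsum //; apply: eq_esum => a _; rewrite mulr1.
rewrite /=; have := total_gt0 x_gt0 y_gt0 x_sum y_sum.
have := tsum_gt0 x_gt0 x_sum I0; have := tsum_gt0 y_gt0 y_sum J0.
move: (tsum x setT * tsum y setT) => z; move=> /lt0r_neq0 ? /lt0r_neq0 ? /lt0r_neq0 ?.
by field; do !(apply/andP; split).
Qed.

(** R5 need not be a rectangle, but it is finite, so the two probabilities are compared as finite
    sums. *)
Lemma cprob_R5 : R5 la !=set0 ->
  cprob P (ends_at la W c) (W 0%N @^-1` R5 la) = formula5 la x y c.
Proof.
move=> [e0 R5e0]; have fR := finite_R5 la; have Z0 := total_gt0 x_gt0 y_gt0 x_sum y_sum.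
rewrite (formula5E la_part x_gt0 y_gt0 hc) /cprob.
rewrite (measure_start_ends_at la_part x_gt0 y_gt0 HW hc) (measure_start HW).
have a0 e : 0 <= absorb c e := absorb_ge0 x_gt0 y_gt0 S e hc.
rewrite !esum_fin_fset //=; first last.
- by move=> e _; exact: start_ge0.
- by move=> e _; apply: mulr_ge0 => //; exact: start_ge0.
rewrite /start -mulr_fsuml.
under [X in X / _ = _]eq_fsbigr do rewrite mulrAC.
rewrite -mulr_fsuml.
have : 0 < \sum_(e \in R5 la) (x e.1 * y e.2).
  rewrite (fsbigD1 e0) //= ltr_wpDr ?mulr_gt0 //.
  by apply: fsumr_ge0 => e _; rewrite mulr_ge0 // ltW.
move: (\sum_(e \in R5 la) (x e.1 * y e.2)) Z0 => s; move: (tsum _ _ * _) => z.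
move=> /lt0r_neq0 z0 /lt0r_neq0 s0.
by field; rewrite z0 s0.
Qed.

Lemma cprob_R6 : R6 la !=set0 ->
  cprob P (ends_at la W c) (W 0%N @^-1` R6 la) = formula6 la x y c.
Proof.
move=> [[i j] [/= hi hj]].
have -> : R6 la = `[1, l]%classic `*` `[m + 1, +oo[%classic.
  by apply/seteqP; split=> -[a b] /=; rewrite !in_itv /= andbT.
have J0 : `[m + 1, +oo[%classic !=set0 by exists j; rewrite /= in_itv /= andbT.
have I0 : `[1, l]%classic !=set0 by exists i; rewrite /= in_itv.
rewrite (cprob_rect I0 J0 (esum_row_weight_low x_gt0 y_gt0 S hc)
  (esum_row_weight_high y_gt0 x_gt0 y_sum S' (cornerC hc) (fun _ h => h))).
have := hook_prodE la_part x_gt0 y_gt0 hc.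
have /lt0r_neq0 := tsum_gt0 y_gt0 y_sum J0.
rewrite (tsum_fin x_gt0 (finite_itv_int 1 l)).
have /lt0r_neq0 := tsum_gt0 x_gt0 x_sum I0.
rewrite (tsum_fin x_gt0 (finite_itv_int 1 l)).
rewrite /formula6; case: c => r s /= X0 Y0 ->.
by field; rewrite X0 Y0.
Qed.

Lemma cprob_R7 : R7 la !=set0 ->
  cprob P (ends_at la W c) (W 0%N @^-1` R7 la) = formula7 la x y c.
Proof.
move=> [[i j] [/= hi hj]].
have -> : R7 la = `[l + 1, +oo[%classic `*` `[1, m]%classic.
  by apply/seteqP; split=> -[a b] /=; rewrite !in_itv /= andbT.
have I0 : `[l + 1, +oo[%classic !=set0 by exists i; rewrite /= in_itv /= andbT.
have J0 : `[1, m]%classic !=set0 by exists j; rewrite /= in_itv.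
rewrite (cprob_rect I0 J0
  (esum_row_weight_high x_gt0 y_gt0 x_sum S hc (fun _ h => h))
  (esum_row_weight_low y_gt0 x_gt0 S' (cornerC hc))).
have := hook_prodE la_part x_gt0 y_gt0 hc.
have /lt0r_neq0 := tsum_gt0 y_gt0 y_sum J0.
rewrite (tsum_fin y_gt0 (finite_itv_int 1 m)).
have /lt0r_neq0 := tsum_gt0 x_gt0 x_sum I0.
rewrite /formula7; case: c => r s /= X0 Y0 ->.
by field; rewrite X0 Y0.
Qed.

Lemma cprob_R8 : cprob P (ends_at la W c) (W 0%N @^-1` R8 la) = formula8 la x y c.
Proof.
have -> : R8 la = `[l + 1, +oo[%classic `*` `[m + 1, +oo[%classic.
  by apply/seteqP; split=> -[a b] /=; rewrite !in_itv /= !andbT.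
have I0 : `[l + 1, +oo[%classic !=set0 by exists (l + 1); rewrite /= in_itv /= lexx.
have J0 : `[m + 1, +oo[%classic !=set0 by exists (m + 1); rewrite /= in_itv /= lexx.
rewrite (cprob_rect I0 J0
  (esum_row_weight_high x_gt0 y_gt0 x_sum S hc (fun _ h => h))
  (esum_row_weight_high y_gt0 x_gt0 y_sum S' (cornerC hc) (fun _ h => h))).
have := hook_prodE la_part x_gt0 y_gt0 hc.
have /lt0r_neq0 := tsum_gt0 y_gt0 y_sum J0.
have /lt0r_neq0 := tsum_gt0 x_gt0 x_sum I0.
rewrite /formula8 => X0 Y0 ->.
by field; rewrite X0 Y0.
Qed.

(** The whole plane is treated as one rectangle; the regions from which [c] is unreachable enter
    with weight 0. *)
Lemma prob_ends_at : P (ends_at la W c) = (formula_all la x y c)%:E.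
Proof.
have := measure_start_ends_at la_part x_gt0 y_gt0 HW hc setT.
rewrite preimage_setT setIT -setXTT => ->.
rewrite (esum_start_rect x_gt0 y_gt0 x_sum y_sum _ _
  (esum_row_weight x_gt0 y_gt0 x_sum S hc)
  (esum_row_weight y_gt0 x_gt0 y_sum S' (cornerC hc))); last first.
- exact: (row_weight_ge0 y_gt0 x_gt0 S' (cornerC hc)).
- exact: (row_weight_ge0 x_gt0 y_gt0 S hc).
have := hook_prodE la_part x_gt0 y_gt0 hc.
by rewrite /formula_all; case: c => r s /= ->; congr EFin; ring.
Qed.

End walk_formulas.

Theorem theorem4 (R : realType) (la : seq nat) (x y : int -> R)
    (la_part : is_partition la)
    (x_gt0 : forall i : int, 0 < x i) (y_gt0 : forall j : int, 0 < y j)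
    (x_sum : summable [set: int] (fun i => (x i)%:E))
    (y_sum : summable [set: int] (fun j => (y j)%:E)) :
  (forall (d : measure_display) (T : measurableType d) (P : probability T R)
      (W : nat -> T -> square), hook_walk la x y P W ->
    forall c : square, outer_corner la c ->
    [/\ R5 la !=set0 ->
          cprob P (ends_at la W c) (W 0%N @^-1` R5 la) = formula5 la x y c,
        R6 la !=set0 ->
          cprob P (ends_at la W c) (W 0%N @^-1` R6 la) = formula6 la x y c,
        R7 la !=set0 ->
          cprob P (ends_at la W c) (W 0%N @^-1` R7 la) = formula7 la x y c,
        cprob P (ends_at la W c) (W 0%N @^-1` R8 la) = formula8 la x y c &
        P (ends_at la W c) = (formula_all la x y c)%:E]) /\
  [/\ R5 la !=set0 -> \sum_(c \in outer_corner la) formula5 la x y c = 1,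
      R6 la !=set0 -> \sum_(c \in outer_corner la) formula6 la x y c = 1,
      R7 la !=set0 -> \sum_(c \in outer_corner la) formula7 la x y c = 1 &
      \sum_(c \in outer_corner la) formula8 la x y c = 1].
Proof.
split=> [d T P W HW c|].
  rewrite outer_cornersE // => hc; split.
  - exact: (cprob_R5 la_part x_gt0 y_gt0 x_sum y_sum HW hc).
  - exact: (cprob_R6 la_part x_gt0 y_gt0 x_sum y_sum HW hc).
  - exact: (cprob_R7 la_part x_gt0 y_gt0 x_sum y_sum HW hc).
  - exact: (cprob_R8 la_part x_gt0 y_gt0 x_sum y_sum HW hc).
  - exact: (prob_ends_at la_part x_gt0 y_gt0 x_sum y_sum HW hc).
split.
- exact: sum_formula5.
- exact: sum_formula6.
- exact: sum_formula7.
- exact: sum_formula8.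
Qed.
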